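(* Let $k$ be $\mathbb{R}$ or $\mathbb{C}$ and let $\mathfrak{g}$ be a finite-dimensional Lie algebra over $k$. The space $Z^2(\mathfrak{g})$ of (one-dimensional) central extensions of $\mathfrak{g}$ has a Lie–Poisson structure, given by the Lie algebra $\bigwedge^2\mathfrak{g}/\delta_{\mathfrak{g}}\bigwedge^3\mathfrak{g}$ (whose dual is $Z^2(\mathfrak{g})$) with bracket $\llbracket\alpha,\beta\rrbracket=\delta_{\mathfrak{g}}\alpha\wedge\delta_{\mathfrak{g}}\beta$, which is defined by the short exact sequence (central extension) of Lie algebras $$\mathfrak{a}^{b_2}\hookrightarrow \bigwedge\nolimits^2\mathfrak{g}\big/\delta_{\mathfrak{g}}\bigwedge\nolimits^3\mathfrak{g}\twoheadrightarrow[\mathfrak{g},\mathfrak{g}],$$ with the Poisson structure on each gauge orbit being the Lie–Poisson structure associated to $[\mathfrak{g},\mathfrak{g}]$.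
   Context: $\mathfrak{a}$ is the one-dimensional abelian Lie algebra and $b_2=\dim H_2(\mathfrak{g})$. $d_{\mathfrak{g}}:\bigwedge^n\mathfrak{g}^\vee\to\bigwedge^{n+1}\mathfrak{g}^\vee$ is the Chevalley–Eilenberg differential (trivial coefficients), $$(d_{\mathfrak{g}}X)(\alpha_1,\ldots,\alpha_{n+1})=\sum_{i<j}(-1)^{i+j}X([\alpha_i,\alpha_j],\alpha_1,\ldots,\hat\alpha_i,\ldots,\hat\alpha_j,\ldots,\alpha_{n+1}),$$ and $\delta_{\mathfrak{g}}:\bigwedge^{n+1}\mathfrak{g}\to\bigwedge^{n}\mathfrak{g}$ is its adjoint under the natural pairing $(\cdot,\cdot)$ of $\bigwedge^n\mathfrak{g}^\vee$ and $\bigwedge^n\mathfrak{g}$. The space of one-dimensional central extensions of $\mathfrak{g}$ is identified with $Z^2(\mathfrak{g})=\ker d_{\mathfrak{g}}\cap\bigwedge^2\mathfrak{g}^\vee$. The gauge action of $\lambda\in\mathfrak{g}^\vee$ on $Z^2(\mathfrak{g})$ is translation by $d_{\mathfrak{g}}\lambda$, so gauge orbits are the cosets of $d_{\mathfrak{g}}\mathfrak{g}^\vee$. The Poisson bracket of $f,g\in C^\infty(Z^2(\mathfrak{g}))$ is $\{f,g\}(X)=(X,\delta_{\mathfrak{g}}Df\wedge\delta_{\mathfrak{g}}Dg)$, where $Df$ denotes the differential of $f$, with values in $Z^2(\mathfrak{g})^\vee\cong\bigwedge^2\mathfrak{g}/\delta_{\mathfrak{g}}\bigwedge^3\mathfr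ak{g}$.
   Formalization: The Poisson structure on the gauge orbit of X is proved to be the affine Lie–Poisson structure of [g,g], with constant term the cocycle X restricted to [g,g]; it is the Lie–Poisson structure of [g,g] itself, after a translation, when that restriction is a coboundary. The literal claim fails in general. *)

(* Defs.v *)
From HB Require Import structures.
From mathcomp Require Import all_boot all_order all_algebra complex.
From mathcomp Require Import all_classical all_reals.
From mathcomp Require Import topology normedtype derive ring.
Set Implicit Arguments.
Unset Strict Implicit.
Unset Printing Implicit Defensive.
Import Order.TTheory GRing.Theory Num.Theory.
Import numFieldNormedType.Exports.
Local Open Scope classical_set_scope.
Local Open Scope ring_scope.

Inductive real_or_complex := RealScalars | ComplexScalars.

Definition scalars (R : realType) (c : real_or_complex) : numFieldType :=
  match c with RealScalars => R | ComplexScalars => R[i] end.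

Section LinearAlgebra.
Context {K : fieldType}.
Implicit Types V W : vectType K.

Definition dual V : vectType K := 'Hom(V, K^o).

Definition bidual V : 'Hom(V, dual (dual V)) :=
  linfun (fun v => linfun (fun l : dual V => l v) : dual (dual V)).

Definition transpose V W (f : 'Hom(V, W)) : 'Hom(dual W, dual V) :=
  linfun (fun l : dual W => (l \o f)%VF : dual V).

(* The subspace with a prescribed membership predicate; it is meaningful when
   P is closed under linear combinations, see [mem_subspace_of]. *)
Definition subspace_of V (P : set V) : {vspace V} :=
  xget 0%VS [set U : {vspace V} | forall v, v \in U <-> P v].

(* The quotient V / U, modelled on a complement of U: [quot_class] is the
   canonical surjection, with kernel U, and [quot_repr] a linear section. *)
Definition quotv V (U : {vspace V}) : vectType K := subvs_of (U^C)%VS.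

Definition quot_class V (U : {vspace V}) : 'Hom(V, quotv U) :=
  linfun (fun v => vsproj (U^C)%VS (daddv_pi (U^C)%VS U v) : quotv U).

Definition quot_repr V (U : {vspace V}) : 'Hom(quotv U, V) :=
  linfun (fun q : quotv U => vsval q).

Lemma linfunE V W (f : V -> W) : linear f -> linfun f =1 f.
Proof.
move=> lf v.
pose F : {linear V -> W} := HB.pack f (GRing.isLinear.Build K V W _ f lf).
exact: (lfunE F v).
Qed.

Lemma bidualE V (v : V) (l : dual V) : bidual V v l = l v.
Proof.
have lin w : linear (fun m : dual V => m w).
  by move=> a x y; rewrite add_lfunE scale_lfunE.
rewrite linfunE; first by rewrite linfunE.
by move=> a x y; apply/lfunP => m; rewrite add_lfunE scale_lfunE !linfunE // linearP.
Qed.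

Lemma lker_bidual V : lker (bidual V) = 0%VS.
Proof.
apply/eqP/lker0P => u v /lfunP euv.
rewrite [LHS](coord_vbasis (memvf u)) [RHS](coord_vbasis (memvf v)); apply: eq_bigr => i _.
pose m : 'Hom(V, K^o) := linfun (fun w => coord (vbasis fullv) i w : K^o).
have mE w : m w = coord (vbasis fullv) i w.
  by rewrite /m linfunE // => a x y; rewrite linearP.
by have := euv m; rewrite !bidualE !mE => ->.
Qed.

Lemma limg_bidual V : limg (bidual V) = fullv.
Proof.
apply/eqP; rewrite eqEdim subvf /= limg_dim_eq ?lker_bidual ?capv0 //.
have dimd (W : vectType K) : dim (dual W) = dim W by exact: muln1.
by rewrite !dimvf !dimd.
Qed.

Lemma transposeE V W (f : 'Hom(V, W)) l v : transpose f l v = l (f v).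
Proof.
rewrite linfunE; first by rewrite comp_lfunE.
move=> a x y; apply/lfunP => u.
by rewrite add_lfunE scale_lfunE !comp_lfunE add_lfunE scale_lfunE.
Qed.

Lemma mem_subspace_of V (P : set V) :
  P 0 -> (forall (a : K) u v, P u -> P v -> P (a *: u + v)) ->
  forall v, v \in subspace_of P <-> P v.
Proof.
move=> P0 PD.
have /xgetPex : exists U : {vspace V}, forall v, v \in U <-> P v; last exact.
have Hn (n : nat) : (exists U : {vspace V}, forall v, v \in U <-> P v) \/
    (exists2 U : {vspace V}, (forall v, v \in U -> P v) & (n <= \dim U)%N).
  elim: n => [|n [|[U UP leU]]]; [| by left |].
    by right; exists 0%VS => // v; rewrite memv0 => /eqP->.
  case: (pselect (forall v, P v -> v \in U)) => [PU|].
    by left; exists U => v; split; [exact: UP | exact: PU].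
  move=> /existsNP[v /not_implyP[Pv vU]]; right; exists (<[v]> + U)%VS.
    move=> w /memv_addP[_ /vlineP[a ->] [u uU ->]].
    exact: PD Pv (UP _ uU).
  apply: leq_ltn_trans leU _; rewrite ltnNge; apply: contra_notN vU => le.
  have /eqP-> : U == (<[v]> + U)%VS by rewrite eqEdim addvSr le.
  exact: (subvP (addvSl _ _) _ (memv_line v)).
have [//|[U _]] := Hn (\dim {:V}).+1.
by rewrite ltnNge dimvS ?subvf.
Qed.

Lemma quot_reprK V (U : {vspace V}) q : quot_class U (quot_repr U q) = q.
Proof.
rewrite !linfunE; last 2 first.
- by move=> a x y; rewrite !linearP.
- by move=> a x y; rewrite !linearP.
rewrite daddv_pi_id ?vsvalK ?subvsP //; first by rewrite capvC capv_compl.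
Qed.

Lemma lker_quot_class V (U : {vspace V}) : lker (quot_class U) = U.
Proof.
have dis : (U^C :&: U = 0)%VS by rewrite capvC capv_compl.
apply/vspaceP => v; rewrite memv_ker linfunE; last by move=> a x y; rewrite !linearP.
have dv : daddv_pi U^C U v + daddv_pi U U^C v = v.
  by apply: daddv_pi_add; rewrite // addvC addv_complf memvf.
apply/eqP/idP => [/(congr1 vsval)|vU].
  rewrite vsprojK ?memv_pi // => /= e0.
  by rewrite -dv e0 add0r memv_pi.
have := dv; rewrite [X in _ + X](daddv_pi_id (capv_compl U)) // => /eqP.
by rewrite -subr_eq0 addrK => /eqP->; rewrite linear0.
Qed.

End LinearAlgebra.

Section Exterior.
Context {K : fieldType} (g : vectType K).

Definition bilin (W : vectType K) (f : g -> g -> W) : 'Hom(g, 'Hom(g, W)) :=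
  linfun (fun a => linfun (f a)).

Definition trilin (W : vectType K) (f : g -> g -> g -> W) :
    'Hom(g, 'Hom(g, 'Hom(g, W))) :=
  linfun (fun a => bilin (f a)).

Definition form2 : vectType K := 'Hom(g, dual g).
Definition form3 : vectType K := 'Hom(g, form2).

Definition alternating2 : {vspace form2} :=
  subspace_of [set X : form2 | forall a, X a a = 0].

Definition alternating3 : {vspace form3} :=
  subspace_of [set X : form3 |
      forall a b, [/\ X a a b = 0, X a b a = 0 & X b a a = 0]].

(* The exterior powers of the dual of g, in degrees 2 and 3, are the spaces of
   alternating forms. *)
Definition dual_ext2 : vectType K := subvs_of alternating2.
Definition dual_ext3 : vectType K := subvs_of alternating3.

(* As g is finite-dimensional, its exterior powers are the spaces paired with
   those of its dual: (X, alpha) is alpha X, and (X, a /\ b) = X(a, b). *)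
Definition ext2 : vectType K := dual dual_ext2.
Definition ext3 : vectType K := dual dual_ext3.

Definition wedge (a b : g) : ext2 :=
  linfun (fun X : dual_ext2 => vsval X a b : K^o).

Lemma bilinE (W : vectType K) (f : g -> g -> W) :
  (forall a, linear (f a)) -> (forall b, linear (f^~ b)) ->
  forall a b, bilin f a b = f a b.
Proof.
move=> lr ll a b; rewrite linfunE; first by rewrite linfunE.
by move=> c x y; apply/lfunP => z; rewrite add_lfunE scale_lfunE !linfunE // ll.
Qed.

Lemma trilinE (W : vectType K) (f : g -> g -> g -> W) :
  (forall a b, linear (f a b)) -> (forall a c, linear (fun b => f a b c)) ->
  (forall b c, linear (fun a => f a b c)) ->
  forall a b c, trilin f a b c = f a b c.
Proof.
move=> l3 l2 l1 a b c; rewrite linfunE; first by rewrite bilinE.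
move=> k x y; apply/lfunP => z; apply/lfunP => t.
by rewrite !(add_lfunE, scale_lfunE) !bilinE // l1.
Qed.

Lemma mem_alternating2 X : X \in alternating2 <-> forall a, X a a = 0.
Proof.
apply: mem_subspace_of => [a|k u v /= hu hv a].
  by rewrite !zero_lfunE.
by rewrite !(add_lfunE, scale_lfunE) hu hv scaler0 addr0.
Qed.

Lemma mem_alternating3 X : X \in alternating3 <->
  forall a b, [/\ X a a b = 0, X a b a = 0 & X b a a = 0].
Proof.
apply: mem_subspace_of => [a b|k u v /= hu hv a b].
  by rewrite !zero_lfunE.
have [u1 u2 u3] := hu a b; have [v1 v2 v3] := hv a b.
by rewrite !(add_lfunE, scale_lfunE) u1 u2 u3 v1 v2 v3 !scaler0 !addr0.
Qed.

Lemma alt2C (X : dual_ext2) a b : vsval X a b = - vsval X b a.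
Proof.
have /mem_alternating2 hX := subvsP X.
have := hX (a + b); rewrite !linearD /= !add_lfunE !hX add0r addr0.
by move=> /eqP; rewrite addrC addr_eq0 => /eqP.
Qed.

Lemma wedgeE a b (X : dual_ext2) : wedge a b X = vsval X a b.
Proof.
by rewrite linfunE // => k u v; rewrite linearP !(add_lfunE, scale_lfunE).
Qed.

Lemma wedge_universal (W : vectType K) (B : g -> g -> W) :
  (forall a, linear (B a)) -> (forall b, linear (B^~ b)) ->
  (forall a, B a a = 0) ->
  exists! f : 'Hom(ext2, W), forall a b, f (wedge a b) = B a b.
Proof.
move=> lr ll alt.
have bE (m : dual W) a b : bilin (fun a b => m (B a b) : K^o) a b = m (B a b).
  by rewrite bilinE // => ? k u v; rewrite ?lr ?ll linearP.
have aE (m : dual W) : bilin (fun a b => m (B a b) : K^o) \in alternating2.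
  by apply/mem_alternating2 => a; rewrite bE alt linear0.
pose T (m : dual W) : dual_ext2 :=
  vsproj alternating2 (bilin (fun a b => m (B a b) : K^o)).
have TE m a b : vsval (T m) a b = m (B a b) by rewrite (vsprojK (aE m)) bE.
have Tlin : linear T.
  move=> k u v; apply/val_inj/lfunP => a; apply/lfunP => b.
  by rewrite TE [in RHS]linearP !(add_lfunE, scale_lfunE) !TE.
have bK (V : vectType K) x : bidual V ((bidual V)^-1%VF x) = x.
  by rewrite limg_lfunVK ?limg_bidual ?memvf.
exists ((bidual W)^-1 \o transpose (linfun T))%VF; split=> [a b|f fE].
  apply: (elimT lker0P (introT eqP (lker_bidual W))); apply/lfunP => m.
  by rewrite comp_lfunE bK transposeE wedgeE linfunE // TE bidualE.
apply/lfunP => x; apply: (elimT lker0P (introT eqP (lker_bidual W))).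
apply/lfunP => m; rewrite comp_lfunE bK transposeE linfunE // bidualE.
pose X := ((bidual dual_ext2)^-1)%VF (m \o f)%VF.
have XE (y : ext2) : y X = m (f y).
  by rewrite -bidualE bK comp_lfunE.
rewrite -XE; congr (x _); apply/val_inj/lfunP => a; apply/lfunP => b.
by rewrite TE -(wedgeE a b X) XE fE.
Qed.

End Exterior.

Arguments bilin {K g W} f.
Arguments trilin {K g W} f.

Record lie_bracket (K : fieldType) (L : vectType K) (br : L -> L -> L) : Prop :=
  LieBracket {
    lie_linearl : forall y, linear (br^~ y);
    lie_linearr : forall x, linear (br x);
    lie_alt : forall x, br x x = 0;
    lie_jacobi : forall x y z,
      br x (br y z) + br y (br z x) + br z (br x y) = 0 }.

Definition lie_hom (K : fieldType) (L M : vectType K)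
    (brL : L -> L -> L) (brM : M -> M -> M) (f : 'Hom(L, M)) :=
  forall x y, f (brL x y) = brM (f x) (f y).

Definition abelian_bracket (K : fieldType) (L : vectType K) (x y : L) : L := 0.

Section ChevalleyEilenberg.
Context {K : fieldType} {g : vectType K} (br : g -> g -> g).

Definition omit (i : nat) (s : seq g) := take i s ++ drop i.+1 s.

(* A form of degree n is applied to sequences of length n; counting the
   arguments from 0 instead of 1 does not change the sign (-1)^(i + j). *)
Definition ce_diff (X : seq g -> K) (s : seq g) : K :=
  \sum_(j < size s) \sum_(i < j)
    (-1) ^+ (i + j) * X (br s`_i s`_j :: omit i (omit j s)).

Definition ce_d1 : 'Hom(dual g, dual_ext2 g) :=
  linfun (fun l : dual g =>
    vsproj (alternating2 g)
      (bilin (fun a b => ce_diff (fun s => l s`_0) [:: a; b] : K^o))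
    : dual_ext2 g).

Definition ce_d2 : 'Hom(dual_ext2 g, dual_ext3 g) :=
  linfun (fun X : dual_ext2 g =>
    vsproj (alternating3 g)
      (trilin (fun a b c =>
        ce_diff (fun s => vsval X s`_0 s`_1) [:: a; b; c] : K^o))
    : dual_ext3 g).

(* [g], the first exterior power of itself, is identified with its bidual. *)
Definition ce_delta1 : 'Hom(ext2 g, g) := ((bidual g)^-1 \o transpose ce_d1)%VF.

Definition ce_delta2 : 'Hom(ext3 g, ext2 g) := transpose ce_d2.

Definition cocycles : vectType K := subvs_of (lker ce_d2).

Definition ext_quot : vectType K := quotv (limg ce_delta2).

Definition ext_class : 'Hom(ext2 g, ext_quot) := quot_class (limg ce_delta2).

(* H_2(g) = ker delta / im delta *)
Definition homology2 : vectType K :=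
  quotv (linfun (fun x => vsproj (lker ce_delta1) x) @: limg ce_delta2)%VS.

Definition betti2 : nat := \dim {:homology2}.

(* The maps induced by the pairing and by delta, computed on representatives. *)
Definition cocycle_pairing : 'Hom(ext_quot, dual cocycles) :=
  linfun (fun q : ext_quot =>
    linfun (fun X : cocycles => quot_repr (limg ce_delta2) q (vsval X) : K^o)
    : dual cocycles).

Definition delta_quot : 'Hom(ext_quot, g) :=
  (ce_delta1 \o quot_repr (limg ce_delta2))%VF.

Definition ext_bracket (q r : ext_quot) : ext_quot :=
  ext_class (wedge (delta_quot q) (delta_quot r)).

(* [g, g]; the brackets of basis elements span it by bilinearity. *)
Definition derived : {vspace g} :=
  <<[seq br a b | a <- vbasis {:g}, b <- vbasis {:g}]>>%VS.

Definition derived_alg : vectType K := subvs_of derived.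

Definition derived_bracket (x y : derived_alg) : derived_alg :=
  vsproj derived (br (vsval x) (vsval y)).

(* The sign comes from delta (a /\ b) = - [a, b]: it is - delta which is a
   morphism of Lie algebras. *)
Definition quot_to_derived : 'Hom(ext_quot, derived_alg) :=
  linfun (fun q : ext_quot => vsproj derived (- delta_quot q) : derived_alg).

Definition gauge_orbit (X : cocycles) : set cocycles :=
  [set Y | exists l : dual g, vsval Y = vsval X + ce_d1 l].

Definition cocycle_on_derived (X : cocycles) (x y : derived_alg) : K :=
  vsval (vsval X) (vsval x) (vsval y).

Hypothesis hbr : lie_bracket br.

Lemma lie_brC a b : br a b = - br b a.
Proof.
have [ll lr alt _] := hbr.
have addl x y z : br (x + y) z = br x z + br y z.
  by have := ll z 1 x y; rewrite !scale1r.
have addr x y z : br x (y + z) = br x y + br x z.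
  by have := lr x 1 y z; rewrite !scale1r.
have := alt (a + b); rewrite addl !addr !alt add0r addr0.
by move=> /eqP; rewrite addr_eq0 => /eqP.
Qed.

Lemma ce_d1E (l : dual g) a b : vsval (ce_d1 l) a b = - l (br a b).
Proof.
have [ll lr alt _] := hbr.
have cE (m : dual g) x y :
    ce_diff (fun s => m s`_0) [:: x; y] = - m (br x y).
  rewrite /ce_diff !big_ord_recl !big_ord0 /= !(add0r, addr0) /=.
  by rewrite /bump /= expr1 mulN1r.
have bE (m : dual g) x y :
    bilin (fun a b => ce_diff (fun s => m s`_0) [:: a; b] : K^o) x y
    = - m (br x y).
  rewrite bilinE ?cE // => z k u v; rewrite !cE ?lr ?ll linearP opprD scalerN //.
have aE (m : dual g) :
    bilin (fun a b => ce_diff (fun s => m s`_0) [:: a; b] : K^o)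
    \in alternating2 g.
  by apply/mem_alternating2 => x; rewrite bE alt linear0 oppr0.
rewrite linfunE; first by rewrite vsprojK ?aE // bE.
move=> k u v; apply/val_inj; rewrite linearP /= !vsprojK ?aE //.
apply/lfunP => x; apply/lfunP => y.
by rewrite !(add_lfunE, scale_lfunE, bE) opprD scalerN.
Qed.

Lemma ce_delta1E (l : dual g) (alpha : ext2 g) : l (ce_delta1 alpha) = alpha (ce_d1 l).
Proof.
rewrite /ce_delta1 comp_lfunE -bidualE -comp_lfunE.
by rewrite !comp_lfunE limg_lfunVK ?limg_bidual ?memvf // transposeE.
Qed.

Lemma ce_delta1_wedge a b : ce_delta1 (wedge a b) = - br a b.
Proof.
apply: (elimT lker0P (introT eqP (lker_bidual g))); apply/lfunP => l.
by rewrite !bidualE ce_delta1E wedgeE ce_d1E linearN.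
Qed.

Lemma mem_derived a b : br a b \in derived.
Proof.
have [ll lr _ _] := hbr.
have br0 y : br 0 y = 0 by have := ll y (-1) 0 0; rewrite scaler0 addr0 scaleN1r addNr.
have brr0 y : br y 0 = 0 by have := lr y (-1) 0 0; rewrite scaler0 addr0 scaleN1r addNr.
rewrite (coord_vbasis (memvf a)) (coord_vbasis (memvf b)).
elim/big_rec: _ => [|i x _ IHx]; first by rewrite br0 mem0v.
rewrite ll rpredD ?rpredZ //.
elim/big_rec: _ {IHx} => [|j y _ IHy]; first by rewrite brr0 mem0v.
rewrite lr rpredD ?rpredZ // memv_span //.
by apply/allpairsP; exists ((vbasis fullv)`_i, (vbasis fullv)`_j);
  rewrite !mem_nth ?size_tuple.
Qed.

Lemma derived_bracketE (x y : derived_alg) :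
  vsval (derived_bracket x y) = br (vsval x) (vsval y).
Proof. by rewrite vsprojK ?mem_derived. Qed.

Lemma ce_d2E (X : dual_ext2 g) a b c :
  vsval (ce_d2 X) a b c =
  - vsval X (br a b) c + vsval X (br a c) b - vsval X (br b c) a.
Proof.
have [ll lr alt _] := hbr.
pose F (X : dual_ext2 g) a b c :=
  - vsval X (br a b) c + vsval X (br a c) b - vsval X (br b c) a.
have cE (Y : dual_ext2 g) x y z :
    ce_diff (fun s => vsval Y s`_0 s`_1) [:: x; y; z] = F Y x y z.
  rewrite /ce_diff !big_ord_recl !big_ord0 /= !(add0r, addr0) /=.
  rewrite /bump /= /F. ring.
pose T (Y : dual_ext2 g) :=
  trilin (fun a b c =>
    ce_diff (fun s => vsval Y s`_0 s`_1) [:: a; b; c] : K^o).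
have bE Y x y z : T Y x y z = F Y x y z.
  rewrite /T trilinE ?cE // => [p q k u v|p q k u v|p q k u v]; rewrite !cE /F ?lr ?ll !linearP /= ?(add_lfunE, scale_lfunE);
    rewrite /GRing.scale /=; ring.
have aE Y : T Y \in alternating3 g.
  apply/mem_alternating3 => x y; rewrite !bE /F !alt ?(linear0, zero_lfunE).
  rewrite (lie_brC y x); split; rewrite ?(linearN, opp_lfunE) /= ?opprK ?oppr0 ?(add0r, addr0) ?addNr ?subrr //.
rewrite -/(F X a b c) linfunE; first by rewrite (vsprojK (aE X)) bE.
move=> k u v; apply/val_inj; rewrite [RHS]linearP /=.
rewrite (vsprojK (aE (k *: u + v))) (vsprojK (aE u)) (vsprojK (aE v)).
apply/lfunP => x; apply/lfunP => y; apply/lfunP => z.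
rewrite !(add_lfunE, scale_lfunE) !bE /F linearP !(add_lfunE, scale_lfunE).
by rewrite /GRing.scale /=; ring.
Qed.

Lemma ce_d1_cocycle l : ce_d1 l \in lker ce_d2.
Proof.
have [ll lr _ jac] := hbr.
have brN x y : br x (- y) = - br x y.
  have := lr x (-1) y y; rewrite !scaleN1r !addNr => br0.
  have := lr x (-1) y 0.
  by rewrite br0 !addr0 !scaleN1r.
rewrite memv_ker; apply/eqP/val_inj/lfunP => a; apply/lfunP => b; apply/lfunP => c.
rewrite ce_d2E !ce_d1E.
rewrite [RHS](_ : _ = 0); last by rewrite linear0 !zero_lfunE.
rewrite (lie_brC (br a b) c) (lie_brC (br a c) b) (lie_brC (br b c) a).
rewrite (lie_brC a c) brN.
rewrite !(linearN l) /=.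
have := congr1 l (jac a b c); rewrite !(linearD l) (linear0 l) /= => jl.
by rewrite -oppr0 -jl; ring.
Qed.

End ChevalleyEilenberg.

Section SmoothFunctions.
Context {K : numFieldType} {V : vectType K}.

Local Notation basis := (vbasis {:V}).

(* Smoothness of f : V -> K is read in coordinates with respect to a basis of
   V; derivatives are K-linear, so that over the complex numbers the smooth
   functions are the holomorphic ones. *)
Definition in_coords (f : V -> K) : 'rV[K]_(\dim {:V}) -> K :=
  fun r => f (passmx.vecof basis r).

Definition differential (f : V -> K) (x : V) : dual V :=
  linfun (fun v =>
    'd (in_coords f : _ -> K^o) (passmx.rVof basis x) (passmx.rVof basis v) : K^o).

Fixpoint Ck (n : nat) (f : V -> K) : Prop :=
  match n with
  | 0 => continuous (in_coords f)
  | m.+1 => (forall x, differentiable (in_coords f : _ -> K^o) x) /\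
            (forall v, Ck m (fun x => differential f x v))
  end.

Definition smooth (f : V -> K) : Prop := forall n, Ck n f.

Record poisson_bracket (pb : (V -> K) -> (V -> K) -> V -> K) : Prop :=
  PoissonBracket {
    poisson_smooth : forall f h, smooth f -> smooth h -> smooth (pb f h);
    poisson_linear : forall (a : K) f1 f2 h,
      smooth f1 -> smooth f2 -> smooth h -> forall x,
      pb (fun y => a * f1 y + f2 y) h x = a * pb f1 h x + pb f2 h x;
    poisson_antisym : forall f h, smooth f -> smooth h -> forall x,
      pb f h x = - pb h f x;
    poisson_leibniz : forall f h1 h2, smooth f -> smooth h1 -> smooth h2 ->
      forall x, pb f (fun y => h1 y * h2 y) x = pb f h1 x * h2 x + h1 x * pb f h2 x;
    poisson_jacobi : forall f1 f2 f3, smooth f1 -> smooth f2 -> smooth f3 ->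
      forall x, pb f1 (pb f2 f3) x + pb f2 (pb f3 f1) x + pb f3 (pb f1 f2) x = 0 }.

End SmoothFunctions.

(* Lie-Poisson brackets on a space Z identified with the dual of a Lie algebra L
   through [pair : L -> Z^dual]; the usual one, on Z = [dual L], is obtained for
   [pair = bidual L]. *)
Section LiePoisson.
Context {K : numFieldType} {L Z : vectType K}.
Variables (pair : 'Hom(L, dual Z)) (br : L -> L -> L).

Definition gradient (f : Z -> K) (X : Z) : L := (pair^-1)%VF (differential f X).

Definition lie_poisson (f h : Z -> K) (X : Z) : K :=
  pair (br (gradient f X) (gradient h X)) X.

(* The affine Lie-Poisson bracket: its linear part is the Lie-Poisson bracket
   of L, and its constant part is a 2-cocycle c of L.  On the gauge orbit of a
   cocycle X of g, c is the restriction of X to [g, g]; it cannot be gauged away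
   in general, since this restriction need not be a coboundary of [g, g]. *)
Definition affine_lie_poisson (c : L -> L -> K) (f h : Z -> K) (X : Z) : K :=
  lie_poisson f h X + c (gradient f X) (gradient h X).

End LiePoisson.

(* {f, h}(X) = (X, delta Df /\ delta Dh) on Z^2(g) *)
Definition cocycle_poisson (K : numFieldType) (g : vectType K)
    (br : g -> g -> g) (f h : cocycles br -> K) (X : cocycles br) : K :=
  wedge (delta_quot br (gradient (cocycle_pairing br) f X))
        (delta_quot br (gradient (cocycle_pairing br) h X)) (vsval X).

(* Main.v *)
Require Import Defs.
From HB Require Import structures.
From mathcomp Require Import all_boot all_order all_algebra complex.
From mathcomp Require Import all_classical all_reals.
From mathcomp Require Import topology normedtype derive ring.
Set Implicit Arguments.
Unset Strict Implicit.
Unset Printing Implicit Defensive.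
Import Order.TTheory GRing.Theory Num.Theory.
Import numFieldNormedType.Exports.
Local Open Scope classical_set_scope.
Local Open Scope ring_scope.

(* A class of the quotient is determined by its values on cocycles, so every
   identity there reduces to one about a closed form X; the Jacobi identity, for
   instance, is d X = 0.  All the brackets of the statement are instances of the
   affine bracket {f, h}(X) = (X, [Df, Dh]) + c(Df, Dh) with c a 2-cocycle.  With
   H_i the Hamiltonian vector of f_i at X, the cyclic sum in its Jacobi identity is
   the Jacobi and cocycle identity for Df_1, Df_2, Df_3 plus terms
   D^2 f_i (H_j, H_k) - D^2 f_i (H_k, H_j), which vanish by the symmetry of second
   derivatives.  Over the complex numbers this symmetry is deduced from the real
   one, applied to the real and imaginary parts restricted to real planes. *)

(** * Calculus in coordinates *)

Section Calculus.
Context {K : numFieldType}.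
Implicit Types V W : vectType K.

Local Notation vec_coords := (passmx.rVof (vbasis _)).
Local Notation of_coords := (passmx.vecof (vbasis _)).

Lemma vec_coordsK {V} : cancel (passmx.rVof (vbasis {:V})) (passmx.vecof (vbasis {:V})).
Proof. exact/passmx.rVofK/vbasisP. Qed.

Lemma vec_coordsD {V} : {morph passmx.rVof (vbasis {:V}) : u v / u + v}.
Proof.
by move=> u v; have := passmx.rVof_linear (vbasis _) 1 u v; rewrite !scale1r.
Qed.

Definition vdifferentiable {V} (f : V -> K) :=
  forall x, differentiable (in_coords f : _ -> K^o) x.

Lemma differentialE {V} (f : V -> K) x v :
  differential f x v
  = 'd (in_coords f : _ -> K^o) (vec_coords x) (vec_coords v).
Proof. by rewrite linfunE // => a u w; rewrite passmx.rVof_linear linearP. Qed.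

(** A linear map on rows is a finite sum of continuous coordinate functions, each multiplied by a
    fixed vector. *)
Lemma row_linear_continuous m (W : normedModType K) (f : {linear 'rV[K]_m -> W}) :
  continuous f.
Proof.
have -> : (f : _ -> W) = fun r : 'rV[K]_m => \sum_i r 0 i *: f (delta_mx 0 i).
  apply/funext => r; rewrite [in LHS](row_sum_delta r) linear_sum.
  by apply: eq_bigr => i _; rewrite linearZ.
elim: (index_enum _) => [|i s IHs] r.
  by under eq_fun do rewrite big_nil; exact: cst_continuous.
under eq_fun do rewrite big_cons.
apply: continuousD (IHs r).
apply: (continuous_comp (f := fun r : 'rV[K]_m => r 0 i) (g := *:%R^~ _)).
  exact: coord_continuous.
exact: scalel_continuous.
Qed.

(** The chain rule: in coordinates the affine map is the map [B] of row spaces followed by a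
    translation. It is what allows functions to be pulled back to gauge orbits. *)
Lemma vdifferentiable_affine {V W} (A : 'Hom(V, W)) (w0 : W) (f : W -> K) :
  vdifferentiable f -> vdifferentiable (fun v => f (w0 + A v)) /\
  forall v, differential (fun v => f (w0 + A v)) v
            = (differential f (w0 + A v) \o A)%VF.
Proof.
move=> df.
pose B0 r := vec_coords (A (of_coords r)).
have linB : linear B0.
  by move=> a r t; rewrite /B0 passmx.vecof_linear linearP passmx.rVof_linear.
pose B : {linear _ -> _} := HB.pack B0 (GRing.isLinear.Build K _ _ _ B0 linB).
pose T r := vec_coords w0 + B r.
have cE : in_coords (fun v => f (w0 + A v)) = in_coords f \o T.
  apply/funext => r; rewrite /in_coords /T /=.
  by rewrite -vec_coordsD vec_coordsK.
have dB x : is_diff x B B.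
  have cB : continuous B by exact: row_linear_continuous.
  by apply: DiffDef; [exact: linear_differentiable | exact: diff_lin].
have dT x : is_diff x T B.
  have := @is_diffD _ _ _ _ _ _ _ x (is_diff_cst (vec_coords w0) x) (dB x).
  by rewrite add0r.
have dfT x : is_diff x (in_coords f \o T : _ -> K^o)
    ('d (in_coords f : _ -> K^o) (T x) \o B).
  by apply: is_diff_comp; exact/differentiableP.
split=> [x|v]; first by rewrite cE; apply: ex_diff.
apply/lfunP => u; rewrite comp_lfunE !differentialE cE diff_val /=.
by rewrite /T /B /= /B0 !vec_coordsK -vec_coordsD.
Qed.

Lemma vdifferentiable_cst {V} (a : K) :
  vdifferentiable (fun _ : V => a) /\
  forall x, differential (fun _ : V => a) x = 0.
Proof.
split=> x; first exact: differentiable_cst.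
by apply/lfunP => v; rewrite differentialE diff_cst zero_lfunE.
Qed.

Lemma vdifferentiable_form {V} (l : dual V) :
  vdifferentiable l /\ forall x, differential l x = l.
Proof.
pose B0 r : K^o := l (of_coords r).
have linB : linear B0 by move=> a r t; rewrite /B0 passmx.vecof_linear linearP.
pose B : {linear _ -> _} := HB.pack B0 (GRing.isLinear.Build K _ _ _ B0 linB).
have cB : continuous B by exact: row_linear_continuous.
split=> x; first exact: (@linear_differentiable _ _ _ B).
apply/lfunP => v; rewrite differentialE.
by rewrite (@diff_lin _ _ _ B) //= /B0 vec_coordsK.
Qed.

Lemma vdifferentiableD {V} (f h : V -> K) :
  vdifferentiable f -> vdifferentiable h ->
  vdifferentiable (fun x => f x + h x) /\
  forall x, differential (fun x => f x + h x) x
            = differential f x + differential h x.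
Proof.
move=> df dh; split=> x; first exact: differentiableD.
apply/lfunP => v; rewrite add_lfunE !differentialE.
by rewrite (diffD (df _) (dh _)).
Qed.

Lemma vdifferentiableM {V} (f h : V -> K) :
  vdifferentiable f -> vdifferentiable h ->
  vdifferentiable (fun x => f x * h x) /\
  forall x, differential (fun x => f x * h x) x
            = f x *: differential h x + h x *: differential f x.
Proof.
move=> df dh; split=> x; first exact: differentiableM.
apply/lfunP => v; rewrite add_lfunE !scale_lfunE !differentialE.
rewrite (diffM (df _) (dh _)) /=.
by rewrite /in_coords !vec_coordsK.
Qed.

(** Replaces the hierarchy [Ck] by a one-step unfolding; the continuity required at level 0 follows
    from differentiability. *)
Lemma smoothP {V} (f : V -> K) :
  smooth f <-> vdifferentiable f /\ forall v, smooth (fun x => differential f x v).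
Proof.
split=> [sf|[df sf] [|n]].
- split; first by have [] := sf 1.
  by move=> v n; have [_] := sf n.+1; apply.
- by move=> x; exact/differentiable_continuous/df.
- by split=> // v; apply: sf.
Qed.

(** Coinduction: in a class of differentiable functions stable under directional derivatives,
    induction on the order gives every [Ck]. *)
Lemma smooth_coind {V} (S : (V -> K) -> Prop) :
  (forall f, S f -> vdifferentiable f) ->
  (forall f, S f -> forall v, S (fun x => differential f x v)) ->
  forall f, S f -> smooth f.
Proof.
move=> Sd SD f Sf n; elim: n f Sf => [|n IHn] f Sf.
  by move=> x; exact/differentiable_continuous/Sd.
by split=> [|v]; [exact: Sd | exact/IHn/SD].
Qed.

(* The set of products of smooth functions is not stable under differentiation,
   but the algebra generated by the smooth functions is. *)
Inductive smooth_algebra {V} : (V -> K) -> Prop :=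
| smooth_algebra_base f : smooth f -> smooth_algebra f
| smooth_algebraD f h : smooth_algebra f -> smooth_algebra h ->
    smooth_algebra (fun x => f x + h x)
| smooth_algebraM f h : smooth_algebra f -> smooth_algebra h ->
    smooth_algebra (fun x => f x * h x).

Lemma smooth_algebra_smooth {V} (f : V -> K) : smooth_algebra f -> smooth f.
Proof.
apply: smooth_coind => {}f.
  elim=> {f} [f /smoothP[]//|f h _ df _ dh|f h _ df _ dh].
    by case: (vdifferentiableD df dh).
  by case: (vdifferentiableM df dh).
(* Both properties are proved in one induction, because the sum and product rules for the
   derivatives need differentiability of the parts. *)
move=> Sf; suff [] : vdifferentiable f /\
  forall v, smooth_algebra (fun x => differential f x v) by [].
elim: Sf => {f} [f /smoothP[df sf]|f h _ [df sf] _ [dh sh]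
  |f h Sf [df sf] Sh [dh sh]].
- by split=> // v; apply: smooth_algebra_base.
- have [d E] := vdifferentiableD df dh; split=> // v.
  under eq_fun do rewrite E add_lfunE.
  exact: smooth_algebraD.
- have [d E] := vdifferentiableM df dh; split=> // v.
  under eq_fun do rewrite E add_lfunE !scale_lfunE.
  by apply: smooth_algebraD; exact: smooth_algebraM.
Qed.

Lemma smoothD {V} (f h : V -> K) :
  smooth f -> smooth h -> smooth (fun x => f x + h x).
Proof.
by move=> sf sh; apply/smooth_algebra_smooth/smooth_algebraD; apply: smooth_algebra_base.
Qed.

Lemma smoothM {V} (f h : V -> K) :
  smooth f -> smooth h -> smooth (fun x => f x * h x).
Proof.
by move=> sf sh; apply/smooth_algebra_smooth/smooth_algebraM; apply: smooth_algebra_base.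
Qed.

Lemma smooth_cst {V} (a : K) : smooth (fun _ : V => a).
Proof.
apply: (@smooth_coind _ (fun f => exists b, f = fun=> b)); last by exists a.
  by move=> _ [b ->]; case: (@vdifferentiable_cst V b).
move=> _ [b ->] v; exists 0; apply/funext => x.
by have [_ ->] := @vdifferentiable_cst V b; rewrite zero_lfunE.
Qed.

Lemma smooth_form {V} (l : dual V) : smooth l.
Proof.
apply/smoothP; have [d E] := vdifferentiable_form l; split=> // v.
under eq_fun do rewrite E.
exact: smooth_cst.
Qed.

Lemma smooth_sum {V} (I : Type) (r : seq I) (F : I -> V -> K) :
  (forall i, smooth (F i)) -> smooth (fun x => \sum_(i <- r) F i x).
Proof.
move=> sF; elim: r => [|i r IHr].
  by under eq_fun do rewrite big_nil; exact: smooth_cst.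
by under eq_fun do rewrite big_cons; exact: smoothD.
Qed.

(** Coinduction on the class of pullbacks: the derivative of a pullback along v is the pullback of
    the derivative along [A v]. *)
Lemma smooth_affine {V W} (A : 'Hom(V, W)) (w0 : W) (f : W -> K) :
  smooth f -> smooth (fun v => f (w0 + A v)).
Proof.
move=> sf; pose S (h : V -> K) := exists2 f, smooth f & h = fun v => f (w0 + A v).
apply: (@smooth_coind _ S); last by exists f.
  by move=> _ [h /smoothP[dh _] ->]; case: (vdifferentiable_affine A w0 dh).
move=> _ [h /smoothP[dh sh] ->] v.
exists (fun w => differential h w (A v)) => //; apply/funext => x.
by have [_ ->] := vdifferentiable_affine A w0 dh; rewrite comp_lfunE.
Qed.

Lemma differential_affine {V W} (A : 'Hom(V, W)) (w0 : W) (f : W -> K) v :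
  smooth f -> differential (fun v => f (w0 + A v)) v
              = (differential f (w0 + A v) \o A)%VF.
Proof. by move=> /smoothP[df _]; have [_ ->] := vdifferentiable_affine A w0 df. Qed.

Lemma differentialD {V} (f h : V -> K) x : smooth f -> smooth h ->
  differential (fun x => f x + h x) x = differential f x + differential h x.
Proof.
by move=> /smoothP[df _] /smoothP[dh _]; have [_ ->] := vdifferentiableD df dh.
Qed.

Lemma differentialM {V} (f h : V -> K) x : smooth f -> smooth h ->
  differential (fun x => f x * h x) x
  = f x *: differential h x + h x *: differential f x.
Proof.
by move=> /smoothP[df _] /smoothP[dh _]; have [_ ->] := vdifferentiableM df dh.
Qed.

Lemma differential_cst {V} (a : K) (x : V) : differential (fun=> a) x = 0.
Proof. by have [_ ->] := @vdifferentiable_cst V a. Qed.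

Lemma differential_form {V} (l : dual V) x : differential l x = l.
Proof. by have [_ ->] := vdifferentiable_form l. Qed.

Lemma differential_sum {V} (I : Type) (r : seq I) (F : I -> V -> K) x :
  (forall i, smooth (F i)) ->
  differential (fun x => \sum_(i <- r) F i x) x
  = \sum_(i <- r) differential (F i) x.
Proof.
move=> sF; elim: r => [|i r IHr].
  by under eq_fun do rewrite big_nil; rewrite big_nil differential_cst.
under eq_fun do rewrite big_cons.
by rewrite differentialD ?IHr ?big_cons//; exact: smooth_sum.
Qed.

End Calculus.

(** * Symmetry of second derivatives *)

Section MixedDerivatives.
Context {R : realType}.
Implicit Types F A B C E : R -> R -> R.

(** The mean value theorem is applied twice: in the first variable to the difference of F at heights
    h and 0, then in the second variable to [A s]. *)
Lemma mixed_difference F A C (h : R) : 0 < h ->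
  (forall s t : R, is_derive s 1 (F^~ t) (A s t)) ->
  (forall s t : R, is_derive t 1 (A s) (C s t)) ->
  exists s t, [/\ s \in `]0, h[, t \in `]0, h[ &
    F h h - F h 0 - (F 0 h - F 0 0) = C s t * h * h].
Proof.
move=> h0 dF dA.
have dphi (s : R) : is_derive s 1 (F^~ h - F^~ 0) (A s h - A s 0) by exact: is_deriveB.
have cont (f df : R -> R) : (forall s : R, is_derive s 1 f (df s)) ->
    {within `[0, h], continuous f}.
  move=> dfs; apply: continuous_subspaceT => s.
  exact/differentiable_continuous/derivable1_diffP.
have [s sh es] := MVT h0 (fun s _ => dphi s) (cont _ _ dphi).
have [t th et] := MVT h0 (fun t _ => dA s t) (cont _ _ (dA s)).
exists s, t; split=> //.
by move: es; rewrite et !subr0 => <-.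
Qed.

(** Schwarz's theorem: on a small square the double difference of F is the area times a value of C,
    and also the area times a value of E. Continuity at the origin then leaves no room for different
    limits. *)
Lemma mixed_derivatives F A B C E :
  (forall s t : R, is_derive s 1 (F^~ t) (A s t)) ->
  (forall s t : R, is_derive t 1 (A s) (C s t)) ->
  (forall s t : R, is_derive t 1 (F s) (B s t)) ->
  (forall s t : R, is_derive s 1 (B^~ t) (E s t)) ->
  {for (0, 0), continuous (fun p : R * R => C p.1 p.2)} ->
  {for (0, 0), continuous (fun p : R * R => E p.1 p.2)} ->
  C 0 0 = E 0 0.
Proof.
move=> dF dA dF' dB cC cE; apply/eqP; rewrite -subr_eq0 -normr_le0.
rewrite leNgt; apply/negP => n0.
(* With half the distance as tolerance, a common value near both [C 0 0] and [E 0 0] contradicts the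
   triangle inequality. *)
have e0 : 0 < `|C 0 0 - E 0 0| / 2 by rewrite divr_gt0.
have /nbhs_ballP[d /= d0 dP] : \forall p \near ((0, 0) : R * R),
    `|C 0 0 - C p.1 p.2| < `|C 0 0 - E 0 0| / 2 /\
    `|E 0 0 - E p.1 p.2| < `|C 0 0 - E 0 0| / 2.
  near=> p; split; near: p.
    by move/cvgrPdist_lt : cC => /(_ _ e0).
  by move/cvgrPdist_lt : cE => /(_ _ e0).
have [s [t [sd td est]]] := mixed_difference d0 dF dA.
(* The double difference is symmetric in the two variables, so exchanging them gives the second
   estimate. *)
have [t' [s' [td' sd' est']]] := mixed_difference (F := fun t s => F s t) d0
  (fun t s => dF' s t) (fun t s => dB s t).
have inb (r : R) : r \in `]0, d[ -> ball (0 : R) d r.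
  by rewrite in_itv /= /ball /= sub0r normrN => /andP[r0 rd]; rewrite gtr0_norm.
have [/= h1 _] := dP (s, t) (conj (inb _ sd) (inb _ td)).
have [/= _ h2] := dP (s', t') (conj (inb _ sd') (inb _ td')).
have eCE : C s t = E s' t'.
  apply: (mulIf (lt0r_neq0 d0)); apply: (mulIf (lt0r_neq0 d0)).
  by rewrite -est -est'; ring.
move: h2; rewrite -eCE distrC => h2.
have := ltr_leD h1 (ltW h2); rewrite -splitr ltNge => /negP; apply.
by apply: le_trans (ler_normD _ _); rewrite addrA subrK.
Unshelve. all: by end_near.
Qed.

End MixedDerivatives.

(** * Second derivatives over K, restricted to real planes *)

Section Symmetry.
Context {R : realType} {K : numFieldType}.
(* iota embeds R into K, and rho is a real coordinate on K, such as the real or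
   the imaginary part. *)
Variables (iota : {rmorphism R -> K}) (rho : K -> R).
Hypothesis iota_norm : forall r, `|iota r| = iota `|r|.
Hypothesis iota_lt : forall a b, (iota a < iota b) = (a < b).
Hypothesis iota_small : forall e : K, 0 < e -> exists2 d, 0 < d & iota d <= e.
Hypothesis rhoB : forall a b, rho (a - b) = rho a - rho b.
Hypothesis rhoZ : forall r z, rho (iota r * z) = r * rho z.
Hypothesis rho_norm : forall z, iota `|rho z| <= `|z|.

Let iota_continuous : continuous iota.
Proof.
move=> r; apply/cvgrPdist_lt => e /iota_small[d d0 de].
near=> t; rewrite -rmorphB iota_norm; apply: lt_le_trans de.
by rewrite iota_lt; near: t; apply: cvgr_dist_lt.
Unshelve. all: by end_near. Qed.

Let rho_continuous : continuous (rho : K^o -> R).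
Proof.
move=> z; apply/(@cvgrPdist_lt _ _ _ _ (nbhs_filter (z : K^o))) => e e0.
have ie0 : 0 < iota e by have := iota_lt 0 e; rewrite rmorph0 e0.
apply/nbhs_ballP; exists (iota e) => // t.
rewrite -ball_normE /= => zt.
by rewrite -rhoB -iota_lt; apply: le_lt_trans zt.
Qed.

Let iota_dnbhs : iota k @[k --> 0^'] --> 0^'.
Proof.
move=> P P0; have := @iota_continuous 0; rewrite /continuous_at rmorph0 => /(_ _ P0) iP.
change (\forall k \near (0 : R), iota k != 0 -> P (iota k)) in iP.
change (\forall k \near (0 : R), k != 0 -> P (iota k)).
by apply: filterS iP => k /= kP k0; apply: kP; rewrite fmorph_eq0.
Qed.

(** The real difference quotient is [rho] of the one over K at the increment [iota h], as [rho]
    commutes with real scalars; the limit passes through the continuous [rho]. *)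
Let is_derive_restriction (V : vectType K) (f : V -> K) (x u : V) (s : R) :
  vdifferentiable f ->
  is_derive s 1 (fun s : R => rho (f (x + iota s *: u)))
    (rho (differential f (x + iota s *: u) u)).
Proof.
move=> df.
set a := passmx.rVof (vbasis {:V}) (x + iota s *: u).
set w := passmx.rVof (vbasis {:V}) u.
have := @diff_derivable _ _ _ _ a w (df a); rewrite /derivable => /cvg_ex[l lP].
have el : l = differential f (x + iota s *: u) u.
  rewrite differentialE -/a -/w -(deriveE w (df a)).
  by apply/esym/cvg_lim.
rewrite -el.
pose q (h : K) : K^o :=
  h^-1 *: ((in_coords f \o shift a) (h *: w) - in_coords f a).
have cq : rho (q (iota k)) @[k --> 0^'] --> rho l.
  apply: (@cvg_comp _ _ _ (q \o iota) rho _ (nbhs (l : K^o)));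
    last exact: rho_continuous.
  exact: cvg_comp iota_dnbhs lP.
have eq_q : (fun h : R => h^-1 *: (((fun s => rho (f (x + iota s *: u))) \o shift s)
    (h *: 1) - rho (f (x + iota s *: u)))) = rho \o q \o iota.
  apply/funext => h /=; rewrite /q /=.
  rewrite -fmorphV [_ *: (_ - _)]/(_ * _) rhoZ rhoB.
  rewrite /in_coords passmx.vecof_linear !vec_coordsK.
  by rewrite [_%:A]mulr1 rmorphD scalerDl addrCA.
apply: DeriveDef.
  by rewrite /derivable eq_q; apply/cvg_ex; exists (rho l).
by rewrite /derive eq_q; apply/cvg_lim.
Qed.

(** Schwarz's theorem for the real function sending (s, t) to
    [rho (f (x + iota s *: u + iota t *: v))]. *)
Lemma differential_sym_proj (V : vectType K) (f : V -> K) (x u v : V) :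
  smooth f ->
  rho (differential (fun y => differential f y u) x v)
  = rho (differential (fun y => differential f y v) x u).
Proof.
move=> sf; have [df sdf] := (smoothP f).1 sf.
have d1 w : vdifferentiable (fun y => differential f y w).
  by have /smoothP[] := sdf w.
pose p s t := x + iota s *: u + iota t *: v.
have p00 : p 0 0 = x by rewrite /p rmorph0 !scale0r !addr0.
have dt (h : V -> K) (s t : R) : vdifferentiable h ->
    is_derive t 1 (fun t => rho (h (p s t))) (rho (differential h (p s t) v)).
  exact: is_derive_restriction.
have ds (h : V -> K) (s t : R) : vdifferentiable h ->
    is_derive s 1 (fun s : R => rho (h (p s t))) (rho (differential h (p s t) u)).
  move=> dh; rewrite /p addrAC; under eq_fun do rewrite addrAC.
  exact: is_derive_restriction.
have cont w1 w2 : continuous (fun z : R * R =>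
    rho (differential (fun y => differential f y w1) (p z.1 z.2) w2)).
  pose c y := differential (fun y => differential f y w1) y w2.
  pose T (z : R * R) := passmx.rVof (vbasis {:V}) x
    + iota z.1 *: passmx.rVof (vbasis {:V}) u
    + iota z.2 *: passmx.rVof (vbasis {:V}) v.
  (* Level 0 of [Ck] for the second derivative, which is itself smooth. *)
  have cc : continuous (in_coords c : _ -> K^o).
    exact: (((smoothP _).1 (sdf w1)).2 w2 0).
  have scale_cont (h : R * R -> R) (w : 'rV[K]_(\dim {:V})) : continuous h ->
      continuous (fun z => iota (h z) *: w).
    move=> hc z; apply: (continuous_comp (f := iota \o h) (g := *:%R^~ w)).
      by apply: continuous_comp; [exact: hc | exact: iota_continuous].
    exact: scalel_continuous.
  have cT : continuous T.
    move=> z; apply: cvgD; last by apply: (scale_cont snd) => ?; exact: cvg_snd.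
    apply: cvgD; first exact: cvg_cst.
    by apply: (scale_cont fst) => ?; exact: cvg_fst.
  have -> : (fun z : R * R => rho (c (p z.1 z.2))) = rho \o (in_coords c \o T).
    apply/funext => z; rewrite /= /in_coords /T /p.
    rewrite [X in passmx.vecof _ X]addrC passmx.vecof_linear.
    rewrite [X in _ + passmx.vecof _ X]addrC passmx.vecof_linear !vec_coordsK.
    by rewrite -(addrC (iota z.1 *: u + x)) (addrC (iota z.1 *: u)).
  move=> z; apply: (@continuous_comp _ K^o); last exact: rho_continuous.
  by apply: continuous_comp; [exact: cT | exact: cc].
have := @mixed_derivatives R (fun s t => rho (f (p s t)))
  (fun s t => rho (differential f (p s t) u))
  (fun s t => rho (differential f (p s t) v))
  (fun s t => rho (differential (fun y => differential f y u) (p s t) v))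
  (fun s t => rho (differential (fun y => differential f y v) (p s t) u)).
rewrite p00; apply.
- by move=> s t; apply: ds.
- by move=> s t; apply: dt (d1 u).
- by move=> s t; apply: dt.
- by move=> s t; apply: ds (d1 v).
- exact: cont.
- exact: cont.
Qed.

End Symmetry.

Lemma differential_sym (R : realType) (k : real_or_complex)
    (V : vectType (scalars R k)) (f : V -> scalars R k) (x u v : V) :
  smooth f ->
  differential (fun y => differential f y u) x v
  = differential (fun y => differential f y v) x u.
Proof.
case: k V f x u v => V f x u v sf.
  apply: (@differential_sym_proj R R idfun id) => //.
  by move=> e e0; exists e.
have Re_norm (z : R[i]) : (`|complex.Re z|)%:C%C <= `|z|.
  by rewrite normc_def lecR -sqrtr_sqr ler_wsqrtr // lerDl sqr_ge0.
have Im_norm (z : R[i]) : (`|complex.Im z|)%:C%C <= `|z|.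
  by rewrite normc_def lecR -sqrtr_sqr ler_wsqrtr // lerDr sqr_ge0.
(* In the order on the complex numbers a positive element has zero imaginary part, so its real part
   serves as the bound. *)
have small (e : R[i]) : 0 < e -> exists2 d : R, 0 < d & d%:C%C <= e.
  rewrite ltcE /= => /andP[/eqP ei er]; exists (complex.Re e) => //.
  by rewrite lecE /= ei !eqxx lexx.
have norm_real (r : R) : `|r%:C%C| = (`|r|)%:C%C.
  by rewrite normc_def /= expr0n /= addr0 sqrtr_sqr.
have eqReIm (a b : R[i]) :
    complex.Re a = complex.Re b -> complex.Im a = complex.Im b -> a = b.
  by case: a b => [a1 a2] [b1 b2] /= -> ->.
apply: eqReIm.
- apply: (@differential_sym_proj R R[i] (real_complex R) (@complex.Re R)) => //.
  + by move=> a b; rewrite ltcR.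
  + by move=> [a1 a2] [b1 b2].
  + by move=> r [a b] /=; rewrite mul0r subr0.
- apply: (@differential_sym_proj R R[i] (real_complex R) (@complex.Im R)) => //.
  + by move=> a b; rewrite ltcR.
  + by move=> [a1 a2] [b1 b2].
  + by move=> r [a b] /=; rewrite mul0r addr0.
Qed.

(** * Affine Lie-Poisson brackets *)

Record lie_cocycle (K : fieldType) (L : vectType K) (br : L -> L -> L)
    (c : L -> L -> K) : Prop := LieCocycle {
  cocycle_linearl : forall y, linear (c^~ y : L -> K^o);
  cocycle_linearr : forall x, linear (c x : L -> K^o);
  cocycle_alt : forall x, c x x = 0;
  cocycle_jacobi : forall x y z,
    c x (br y z) + c y (br z x) + c z (br x y) = 0 }.

(** * Coordinates on a space identified with the dual of L *)

Section Duality.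
Context {K : fieldType}.
Implicit Types V W : vectType K.

Lemma bidual_invE V (m : dual (dual V)) (l : dual V) :
  l ((bidual V)^-1%VF m) = m l.
Proof. by rewrite -bidualE limg_lfunVK ?limg_bidual ?memvf. Qed.

Lemma dual_combE V (t1 t2 : K) (l1 l2 : dual V) x :
  (t1 *: l1 + t2 *: l2) x = t1 * l1 x + t2 * l2 x.
Proof. by rewrite add_lfunE !scale_lfunE. Qed.

Variables (L Z : vectType K) (pair : 'Hom(L, dual Z)).
Hypothesis pair_inj : lker pair = 0%VS.
Hypothesis pair_surj : limg pair = fullv.

Lemma pairK a : pair^-1%VF (pair a) = a.
Proof. by apply: lker0_lfunK; rewrite pair_inj. Qed.

Lemma pair_invK l : pair (pair^-1%VF l) = l.
Proof. by rewrite limg_lfunVK ?pair_surj ?memvf. Qed.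

(** A form on L becomes, through the identification of L with the dual of Z and the reflexivity of
    Z, a point of Z. *)
Definition dual_vector (m : dual L) : Z := (bidual Z)^-1%VF (m \o pair^-1)%VF.

Lemma dual_vectorE (m : dual L) (l : dual Z) : l (dual_vector m) = m (pair^-1%VF l).
Proof. by rewrite bidual_invE comp_lfunE. Qed.

Definition basis_coord (i : 'I_(\dim {:L})) : dual L :=
  linfun (fun a => coord (vbasis {:L}) i a : K^o).

Definition dual_basis (i : 'I_(\dim {:L})) : Z := dual_vector (basis_coord i).

Lemma pair_inv_dual_basis (l : dual Z) :
  pair^-1%VF l = \sum_i l (dual_basis i) *: (vbasis {:L})`_i.
Proof.
rewrite [LHS](coord_vbasis (memvf _)); apply: eq_bigr => i _.
by rewrite dual_vectorE linfunE // => k a b; rewrite linearP.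
Qed.

(** Expands brackets into finite sums of products of partial derivatives, the form in which they can
    be shown smooth and be differentiated. *)
Lemma bilinear_dual_basis (B : L -> L -> K^o) (l m : dual Z) :
  (forall a, linear (B a)) -> (forall b, linear (B^~ b)) ->
  B (pair^-1%VF l) (pair^-1%VF m)
  = \sum_i \sum_j l (dual_basis i) * m (dual_basis j)
      * B (vbasis {:L})`_i (vbasis {:L})`_j.
Proof.
move=> Br Bl; rewrite -bilinE // !pair_inv_dual_basis.
rewrite [bilin B _]linear_sum sum_lfunE.
apply: eq_bigr => i _; rewrite linear_sum; apply: eq_bigr => j _.
rewrite linearZZ /= [bilin B (_ *: _)]linearZZ scale_lfunE bilinE //.
by rewrite /GRing.scale /= mulrCA mulrA.
Qed.

End Duality.

Section AffineLiePoisson.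
Context {R : realType} {k : real_or_complex}.
Local Notation K := (scalars R k).
Variables (L Z : vectType K) (pair : 'Hom(L, dual Z)) (br : L -> L -> L).
Variable c : L -> L -> K.
Implicit Types f h : Z -> K.
Hypothesis pair_inj : lker pair = 0%VS.
Hypothesis hbr : lie_bracket br.
Hypothesis hc : lie_cocycle br c.

(** The Poisson bivector at X, as a bilinear form on L, whose elements stand for covectors of Z. *)
Let Pi (X : Z) (a b : L) : K^o := pair (br a b) X + c a b.

Let Pi_linearr X a : linear (Pi X a).
Proof.
move=> t x y; rewrite /Pi (lie_linearr hbr) linearP (cocycle_linearr hc).
by rewrite add_lfunE scale_lfunE scalerDr addrACA.
Qed.

Let Pi_linearl X b : linear (Pi X ^~ b).
Proof.
move=> t x y; rewrite /Pi (lie_linearl hbr) linearP (cocycle_linearl hc).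
by rewrite add_lfunE scale_lfunE scalerDr addrACA.
Qed.

Let PiC X a b : Pi X a b = - Pi X b a.
Proof.
apply/eqP; rewrite -addr_eq0; apply/eqP.
have alt d : Pi X d d = 0.
  by rewrite /Pi (lie_alt hbr) (cocycle_alt hc) linear0 zero_lfunE addr0.
have := alt (1 *: a + b); rewrite Pi_linearl !Pi_linearr !alt.
by rewrite !scale1r add0r addr0 addrC.
Qed.

Let Pi_jacobi X a1 a2 a3 :
  Pi X a1 (br a2 a3) + Pi X a2 (br a3 a1) + Pi X a3 (br a1 a2) = 0.
Proof.
have sum6 (p1 p2 p3 q1 q2 q3 : K) : p1 + p2 + p3 = 0 -> q1 + q2 + q3 = 0 ->
    p1 + q1 + (p2 + q2) + (p3 + q3) = 0.
  move=> p0 q0; transitivity ((p1 + p2 + p3) + (q1 + q2 + q3)); first by ring.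
  by rewrite p0 q0 addr0.
apply: sum6; last exact: (cocycle_jacobi hc).
by rewrite -!add_lfunE -!linearD (lie_jacobi hbr) linear0 zero_lfunE.
Qed.

Local Notation grad := (gradient pair).
Local Notation pb := (affine_lie_poisson pair br c).

Let pbE f h X : pb f h X = Pi X (grad f X) (grad h X).
Proof. by []. Qed.

(** The Hamiltonian vector of the covector a at X: the bracket with f is the derivative along it,
    see [pb_ham]. *)
Let ham X a : Z := dual_vector pair (bilin (Pi X) a).

Let hamE X a (l : dual Z) : l (ham X a) = Pi X a (pair^-1%VF l).
Proof. by rewrite dual_vectorE bilinE. Qed.

Let pb_ham f h X : pb f h X = differential h X (ham X (grad f X)).
Proof. by rewrite hamE. Qed.

Local Notation v := (dual_basis pair).
Local Notation e i := ((vbasis {:L})`_i).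

Let Pi_coords X (l m : dual Z) : Pi X (pair^-1%VF l) (pair^-1%VF m) = \sum_i \sum_j
  l (v i) * m (v j) * (pair (br (e i) (e j)) X + c (e i) (e j)).
Proof. exact: bilinear_dual_basis. Qed.

Let br_coords w (l m : dual Z) : pair (br (pair^-1%VF l) (pair^-1%VF m)) w
  = \sum_i \sum_j l (v i) * m (v j) * pair (br (e i) (e j)) w.
Proof.
apply: (@bilinear_dual_basis _ _ _ _ (fun a b => pair (br a b) w)) => [a|b] t x y.
  by rewrite (lie_linearr hbr) linearP add_lfunE scale_lfunE.
by rewrite (lie_linearl hbr) linearP add_lfunE scale_lfunE.
Qed.

Let pb_coords f h : pb f h = fun X => \sum_i \sum_j
  differential f X (v i) * differential h X (v j) * (pair (br (e i) (e j)) X + c (e i) (e j)).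
Proof.
by apply/funext => X; rewrite pbE Pi_coords.
Qed.

Let smooth_partial f w : smooth f -> smooth (fun X => differential f X w).
Proof. by case/smoothP. Qed.

Let smooth_coef i j : smooth (fun X => pair (br (e i) (e j)) X + c (e i) (e j)).
Proof. by apply: smoothD; [exact: smooth_form | exact: smooth_cst]. Qed.

Let smooth_term f h i j : smooth f -> smooth h ->
  smooth (fun X => differential f X (v i) * differential h X (v j)).
Proof. by move=> sf sh; apply: smoothM; exact: smooth_partial. Qed.

Let smooth_pb f h : smooth f -> smooth h -> smooth (pb f h).
Proof.
move=> sf sh; rewrite pb_coords; apply: smooth_sum => i; apply: smooth_sum => j.
by apply: smoothM; [exact: smooth_term | exact: smooth_coef].
Qed.

(** The product rule in coordinates. One term comes from the linear dependence of the bivector on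
    the point, the two others from second derivatives, where symmetry moves w to the inner
    position. *)
Let differential_pb f h X w : smooth f -> smooth h ->
  differential (pb f h) X w = pair (br (grad f X) (grad h X)) w
    + Pi X (grad f X) (grad (fun Y => differential h Y w) X)
    + Pi X (grad (fun Y => differential f Y w) X) (grad h X).
Proof.
move=> sf sh.
have E1 := br_coords w (differential f X) (differential h X).
have E2 := Pi_coords X (differential f X)
  (differential (fun Y => differential h Y w) X).
have E3 := Pi_coords X (differential (fun Y => differential f Y w) X)
  (differential h X).
apply: etrans (esym (congr2 +%R (congr2 +%R E1 E2) E3)); clear E1 E2 E3.
rewrite pb_coords differential_sum; last first.
  move=> i; apply: smooth_sum => j.
  by apply: smoothM; [exact: smooth_term | exact: smooth_coef].
rewrite sum_lfunE -!big_split; apply: eq_bigr => i _.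
rewrite -!big_split differential_sum; last first.
  by move=> j; apply: smoothM; [exact: smooth_term | exact: smooth_coef].
rewrite sum_lfunE; apply: eq_bigr => j _.
rewrite differentialM; [|exact: smooth_term | exact: smooth_coef].
rewrite differentialM; try exact: smooth_partial.
rewrite differentialD; [|exact: smooth_form|exact: smooth_cst].
rewrite differential_form differential_cst addr0.
rewrite !dual_combE [X in _ * (_ * X + _)]differential_sym //.
rewrite [X in _ * (_ + _ * X)]differential_sym //.
have reorder (F H P Q DF DH : K) :
    F * H * P + Q * (F * DH + H * DF) = F * H * P + F * DH * Q + DF * H * Q.
  by ring.
exact: reorder.
Qed.

Lemma affine_lie_poisson_bracket : poisson_bracket pb.
Proof.
split.
- exact: smooth_pb.
- move=> a f1 f2 h s1 s2 sh x; rewrite !pbE.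
  have -> : grad (fun y => a * f1 y + f2 y) x = a *: grad f1 x + grad f2 x.
    (* The scalar is treated as a constant function, so that the product rule applies to the
       multiple. *)
    have sa : smooth (fun _ : Z => a) by exact: smooth_cst.
    rewrite /gradient -linearP differentialD //; last exact: smoothM.
    by rewrite differentialM // differential_cst scaler0 addr0.
  exact: Pi_linearl.
- by move=> f h sf sh x; rewrite !pbE.
- move=> f h1 h2 sf s1 s2 x; rewrite !pb_ham differentialM //.
  by rewrite dual_combE addrC mulrC.
- move=> f1 f2 f3 s1 s2 s3 x.
  (* Second derivatives along Hamiltonian vectors frozen at x. *)
  pose Hess f a b := differential (fun Y => differential f Y (ham x a)) x (ham x b).
  have HessC f a b : smooth f -> Hess f a b = Hess f b a.
    by move=> sf; exact: differential_sym.
  (* The outer bracket is the derivative of [pb g h] along [Ha], the Hamiltonian vector of f at x,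
     expanded by [differential_pb]. *)
  have E f g h : smooth f -> smooth g -> smooth h -> pb f (pb g h) x
      = Pi x (grad f x) (br (grad g x) (grad h x))
        + Hess h (grad f x) (grad g x) - Hess g (grad f x) (grad h x).
    move=> sf sg sh; set Ha := ham x (grad f x).
    have E1 : pair (br (grad g x) (grad h x)) Ha
        = Pi x (grad f x) (br (grad g x) (grad h x)).
      by rewrite hamE (pairK pair_inj).
    have E2 := esym (hamE x (grad g x)
      (differential (fun Y => differential h Y Ha) x)).
    have E3 := esym (hamE x (grad h x)
      (differential (fun Y => differential g Y Ha) x)).
    apply: etrans (pb_ham f (pb g h) x) _.
    apply: etrans (differential_pb x Ha sg sh) _.
    exact: (congr2 +%R (congr2 +%R E1 E2)
      (etrans (PiC _ _ _) (congr1 -%R E3))).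
  have jac : Pi x (grad f1 x) (br (grad f2 x) (grad f3 x))
      + Pi x (grad f2 x) (br (grad f3 x) (grad f1 x))
      + Pi x (grad f3 x) (br (grad f1 x) (grad f2 x)) = 0.
    exact: Pi_jacobi.
  (* In the cyclic sum each function contributes two Hessian terms of opposite sign with exchanged
     arguments. *)
  have cancel (p1 p2 p3 a b d a' b' d' : K) :
      p1 + p2 + p3 = 0 -> a = a' -> b = b' -> d = d' ->
      (p1 + a - b) + (p2 + d - a') + (p3 + b' - d') = 0.
    by move=> p0 -> -> ->; rewrite -[RHS]p0; ring.
  apply: etrans (congr2 +%R (congr2 +%R (E _ _ _ s1 s2 s3) (E _ _ _ s2 s3 s1))
    (E _ _ _ s3 s1 s2)) _.
  apply: cancel jac _ _ _; exact: HessC.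
Qed.

End AffineLiePoisson.

(** * The quotient of the second exterior power *)

Section LinearMaps.
Context {K : fieldType}.
Implicit Types V W : vectType K.

Lemma dual_separates V (u v : V) : (forall l : dual V, l u = l v) -> u = v.
Proof.
move=> luv; apply: (elimT lker0P (introT eqP (lker_bidual V))).
by apply/lfunP => l; rewrite !bidualE.
Qed.

Lemma bijective_lfun V W (f : 'Hom(V, W)) :
  lker f = 0%VS -> limg f = fullv -> bijective f.
Proof.
move=> /eqP kf lf; exists f^-1%VF; first exact: lker0_lfunK.
by move=> w; rewrite limg_lfunVK ?lf ?memvf.
Qed.

Lemma lker0_sep V W (f : 'Hom(V, W)) : (forall v, f v = 0 -> v = 0) -> lker f = 0%VS.
Proof.
move=> f0; apply/eqP; rewrite -subv0; apply/subvP => v.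
by rewrite memv_ker memv0 => /eqP/f0->.
Qed.

Lemma limg_full V W (f : 'Hom(V, W)) : (forall w, exists v, f v = w) -> limg f = fullv.
Proof.
move=> fs; apply/vspaceP => w; rewrite memvf; have [v <-] := fs w.
by rewrite memv_img ?memvf.
Qed.

Lemma limg_fullP V W (f : 'Hom(V, W)) w : limg f = fullv -> exists v, f v = w.
Proof.
by move=> ff; have /memv_imgP[v _ ->] : w \in limg f; rewrite ?ff ?memvf //; exists v.
Qed.

Lemma limg_transpose V W (f : 'Hom(V, W)) : lker f = 0%VS -> limg (transpose f) = fullv.
Proof.
move=> /eqP fi; apply: limg_full => l; exists (l \o f^-1)%VF.
by apply/lfunP => v; rewrite transposeE comp_lfunE lker0_lfunK.
Qed.

(** Used to exhibit the kernel of the extension as $\mathfrak{a}^{b_2}$, modelled by row vectors: a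
    row is sent to the combination of a basis with these coefficients. *)
Lemma subspace_embedding V (U : {vspace V}) n : \dim U = n ->
  exists i : 'Hom('rV[K]_n, V), lker i = 0%VS /\ limg i = U.
Proof.
move=> dU; subst n.
pose f (r : 'rV[K]_(\dim U)) := \sum_j r 0 j *: (vbasis U)`_j.
have flin : linear f.
  move=> a r s; rewrite /f scaler_sumr -big_split; apply: eq_bigr => j _.
  by rewrite !mxE scalerDl scalerA.
have fE : linfun f =1 f by exact: linfunE.
exists (linfun f); split.
  have /freeP fr := basis_free (vbasisP U).
  apply: lker0_sep => r; rewrite fE => /fr r0.
  by apply/rowP => j; rewrite mxE r0.
apply/vspaceP => v; apply/memv_imgP/idP => [[r _ ->]|vU].
  by rewrite fE memv_suml // => j _; rewrite memvZ // vbasis_mem // mem_nth ?size_tuple.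
exists (\row_j coord (vbasis U) j v); first exact: memvf.
by rewrite fE [LHS](coord_vbasis vU); apply: eq_bigr => j _; rewrite mxE.
Qed.

End LinearMaps.

(** * Duality with cocycles, the Lie bracket and the central extension *)

Section CentralExtensions.
Context {K : fieldType} {g : vectType K} (br : g -> g -> g).
Hypothesis hbr : lie_bracket br.
Local Notation Z2 := (cocycles br).
Local Notation Q := (ext_quot br).

Lemma cocycle_pairingE (q : Q) (X : Z2) :
  cocycle_pairing br q X = quot_repr (limg (ce_delta2 br)) q (vsval X).
Proof.
have lin (r : Q) :
    linear (fun X : Z2 => quot_repr (limg (ce_delta2 br)) r (vsval X) : K^o).
  by move=> a x y; rewrite !linearP.
have linE r := linfunE (lin r).
rewrite linfunE; first exact: linE.
move=> a x y; apply/lfunP => Y.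
by rewrite add_lfunE scale_lfunE !linE linearP add_lfunE scale_lfunE.
Qed.

Lemma ce_delta2_cocycle (omega : ext3 g) (X : Z2) : ce_delta2 br omega (vsval X) = 0.
Proof.
have := subvsP X; rewrite memv_ker => /eqP dX.
by rewrite transposeE dX linear0.
Qed.

(** Maps on the quotient are computed on the representative chosen by [quot_repr]; since this
    differs from alpha by a boundary only, they can be evaluated on any representative. *)
Lemma ext_class_repr (alpha : ext2 g) :
  exists omega, quot_repr (limg (ce_delta2 br)) (ext_class br alpha)
                = alpha + ce_delta2 br omega.
Proof.
set r := quot_repr _ _.
have : r - alpha \in lker (ext_class br).
  by rewrite memv_ker linearB /= quot_reprK subrr.
rewrite lker_quot_class => /memv_imgP[omega _ e]; exists omega.
by rewrite -e addrC subrK.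
Qed.

Lemma cocycle_pairing_class alpha (X : Z2) :
  cocycle_pairing br (ext_class br alpha) X = alpha (vsval X).
Proof.
have [omega e] := ext_class_repr alpha.
by rewrite cocycle_pairingE e add_lfunE ce_delta2_cocycle addr0.
Qed.

Lemma ext_classP (q : Q) : exists alpha, q = ext_class br alpha.
Proof. by exists (quot_repr (limg (ce_delta2 br)) q); rewrite quot_reprK. Qed.

(** A bivector alpha that kills all cocycles factors through the differential d on 2-forms, and is
    therefore a boundary. *)
Lemma lker_cocycle_pairing : lker (cocycle_pairing br) = 0%VS.
Proof.
apply: lker0_sep => q; have [alpha ->] := ext_classP q => p0.
have a0 (X : Z2) : alpha (vsval X) = 0 by rewrite -cocycle_pairing_class p0 zero_lfunE.
apply/eqP; rewrite -memv_ker lker_quot_class.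
(* The factor is alpha composed with a partial inverse of d; a form X and the chosen preimage [Y] of
   its differential differ by a cocycle, where alpha vanishes. *)
have -> : alpha = ce_delta2 br (alpha \o (ce_d2 br)^-1)%VF.
  apply/lfunP => X; rewrite transposeE comp_lfunE.
  set Y := ((ce_d2 br)^-1)%VF _.
  have XY : X - Y \in lker (ce_d2 br).
    by rewrite memv_ker linearB /= limg_lfunVK ?memv_img ?memvf // subrr.
  have := a0 (vsproj (lker (ce_d2 br)) (X - Y)).
  by rewrite (vsprojK XY) linearB /= => /eqP; rewrite subr_eq0 => /eqP.
by rewrite memv_img ?memvf.
Qed.

Lemma limg_cocycle_pairing : limg (cocycle_pairing br) = fullv.
Proof.
(* A form on the cocycles extends to all 2-forms by composition with a projection. *)
apply: limg_full => l; exists (ext_class br (l \o linfun (vsproj (lker (ce_d2 br))))%VF).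
by apply/lfunP => X; rewrite cocycle_pairing_class comp_lfunE lfunE /= vsvalK.
Qed.

Lemma ext_quot_eq (q r : Q) :
  (forall X, cocycle_pairing br q X = cocycle_pairing br r X) -> q = r.
Proof.
move=> qr; apply: (elimT lker0P (introT eqP lker_cocycle_pairing)).
exact/lfunP.
Qed.

(** Every form on the cocycles is the pairing with some class, so a cocycle that pairs to zero with
    all classes is zero. *)
Lemma lker_transpose_pairing :
  lker (transpose (cocycle_pairing br) \o bidual Z2)%VF = 0%VS.
Proof.
apply: lker0_sep => X; rewrite comp_lfunE => e0.
apply: dual_separates => l; have [q <-] := limg_fullP l limg_cocycle_pairing.
by rewrite -bidualE -transposeE e0 zero_lfunE linear0.
Qed.

Lemma limg_transpose_pairing :
  limg (transpose (cocycle_pairing br) \o bidual Z2)%VF = fullv.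
Proof.
by rewrite limg_comp limg_bidual limg_transpose // lker_cocycle_pairing.
Qed.

(** The adjoint of the fact that exact 2-forms are closed. *)
Lemma ce_delta1_delta2 omega : ce_delta1 br (ce_delta2 br omega) = 0.
Proof.
apply: dual_separates => l; rewrite ce_delta1E linear0 transposeE.
by have := ce_d1_cocycle hbr l; rewrite memv_ker => /eqP->; rewrite linear0.
Qed.

Lemma delta_quot_class alpha : delta_quot br (ext_class br alpha) = ce_delta1 br alpha.
Proof.
have [omega e] := ext_class_repr alpha.
by rewrite comp_lfunE e linearD /= ce_delta1_delta2 addr0.
Qed.

Lemma ext_bracket_class alpha beta :
  ext_bracket (ext_class br alpha) (ext_class br beta)
  = ext_class br (wedge (ce_delta1 br alpha) (ce_delta1 br beta)).
Proof. by rewrite /ext_bracket !delta_quot_class. Qed.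

Lemma pairing_ext_bracket (q r : Q) (X : Z2) :
  cocycle_pairing br (ext_bracket q r) X
  = vsval (vsval X) (delta_quot br q) (delta_quot br r).
Proof. by rewrite cocycle_pairing_class wedgeE. Qed.

Lemma delta_ext_bracket (q r : Q) :
  delta_quot br (ext_bracket q r) = - br (delta_quot br q) (delta_quot br r).
Proof. by rewrite delta_quot_class ce_delta1_wedge. Qed.

(** The equation d X = 0, put in cyclic form by antisymmetry. *)
Lemma cocycle_cyclic (X : Z2) a b c : let x := vsval (vsval X) in
  x a (br b c) + x b (br c a) + x c (br a b) = 0.
Proof.
have := subvsP X; rewrite memv_ker => /eqP dX x.
have := ce_d2E hbr (vsval X) a b c; rewrite dX linear0 !zero_lfunE.
rewrite (lie_brC hbr a c) linearN opp_lfunE !(alt2C _ (br _ _)) !opprK -/x => e.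
by rewrite [RHS]e addrC [x a _ + _]addrC addrA.
Qed.

Lemma ext_bracket_lie : lie_bracket (@ext_bracket _ _ br).
Proof.
split=> [r|q|q|q r s]; last 2 first.
- apply: ext_quot_eq => X; rewrite pairing_ext_bracket linear0 zero_lfunE.
  by have /mem_alternating2-> := subvsP (vsval X).
(* Paired with X, the Jacobi identity becomes, up to sign, the closedness of X at the three
   boundaries. *)
- apply: ext_quot_eq => X; rewrite !linearD !add_lfunE !pairing_ext_bracket.
  rewrite !delta_ext_bracket !linearN -!opprD cocycle_cyclic.
  by rewrite oppr0 linear0 zero_lfunE.
- move=> a x y; apply: ext_quot_eq => X.
  rewrite linearP add_lfunE scale_lfunE !pairing_ext_bracket.
  by rewrite !linearP add_lfunE scale_lfunE.
- move=> a x y; apply: ext_quot_eq => X.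
  rewrite linearP add_lfunE scale_lfunE !pairing_ext_bracket.
  by rewrite !linearP.
Qed.

Lemma derived_val_inj (x y : derived_alg br) : vsval x = vsval y -> x = y.
Proof. exact: val_inj. Qed.

Lemma derived_bracket_lie : lie_bracket (@derived_bracket _ _ br).
Proof.
split=> [y|x|x|x y z].
- move=> a u v; apply: derived_val_inj; rewrite [RHS]linearP /= !derived_bracketE // linearP.
  exact: (lie_linearl hbr).
- move=> a u v; apply: derived_val_inj; rewrite [RHS]linearP /= !derived_bracketE // linearP.
  exact: (lie_linearr hbr).
- by apply: derived_val_inj; rewrite derived_bracketE // (lie_alt hbr).
- by apply: derived_val_inj; rewrite !linearD /= !derived_bracketE // (lie_jacobi hbr).
Qed.

(** A form vanishing on the derived algebra has zero differential, hence is zero on every boundary.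
    The forms [m \o p] are of this kind, so [p] kills boundaries. *)
Lemma ce_delta1_derived alpha : ce_delta1 br alpha \in derived br.
Proof.
pose p : 'End(g) := (\1 - projv (derived br))%VF.
have p0 : p (ce_delta1 br alpha) = 0.
  apply: dual_separates => m; rewrite linear0.
  transitivity ((m \o p)%VF (ce_delta1 br alpha)); first by rewrite comp_lfunE.
  rewrite ce_delta1E.
  have -> : ce_d1 br (m \o p)%VF = 0; last by rewrite linear0.
  apply/val_inj/lfunP => a; apply/lfunP => b.
  rewrite ce_d1E // comp_lfunE /p add_lfunE opp_lfunE id_lfunE projv_id ?mem_derived //.
  by rewrite subrr linear0 oppr0 linear0 !zero_lfunE.
move: p0; rewrite add_lfunE opp_lfunE id_lfunE => /eqP; rewrite subr_eq0 => /eqP->.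
exact: memv_proj.
Qed.

Lemma quot_to_derivedE (q : Q) : vsval (quot_to_derived br q) = - delta_quot br q.
Proof.
rewrite linfunE; last by move=> a x y; rewrite linearP opprD -scalerN linearP.
by rewrite vsprojK // memvN comp_lfunE ce_delta1_derived.
Qed.

Lemma quot_to_derived_hom :
  lie_hom (@ext_bracket _ _ br) (@derived_bracket _ _ br) (quot_to_derived br).
Proof.
move=> q r; apply: derived_val_inj; rewrite derived_bracketE // !quot_to_derivedE.
rewrite delta_ext_bracket opprK -!(bilinE (lie_linearr hbr) (lie_linearl hbr)).
by rewrite linearN /= [bilin _ (- _)]linearN /= opp_lfunE opprK.
Qed.

Lemma limg_quot_to_derived : limg (quot_to_derived br) = fullv.
Proof.
apply: limg_full => y.
(* The image is viewed inside g, where it suffices to reach the spanning brackets; [a, b] comes from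
   the class of [wedge a b]. *)
pose U := limg (linfun (fun x : derived_alg br => vsval x) \o quot_to_derived br)%VF.
have valE : linfun (fun x : derived_alg br => vsval x) =1 vsval.
  by apply: linfunE => a u v; rewrite linearP.
have : vsval y \in U.
  apply: (subvP _ _ (subvsP y)); apply/span_subvP => _ /allpairsP[[a b] /= [_ _ ->]].
  apply/memv_imgP; exists (ext_class br (wedge a b)); first exact: memvf.
  by rewrite comp_lfunE valE quot_to_derivedE delta_quot_class ce_delta1_wedge // opprK.
case/memv_imgP => q _; rewrite comp_lfunE valE => /val_inj->; by exists q.
Qed.

Lemma mem_lker_quot_to_derived q :
  (q \in lker (quot_to_derived br)) = (delta_quot br q == 0).
Proof.
rewrite memv_ker -(inj_eq val_inj) -[X in X == _]/(vsval _) quot_to_derivedE.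
by rewrite linear0 oppr_eq0.
Qed.

(** The bracket depends on q only through its boundary. *)
Lemma ext_bracket_central q r : q \in lker (quot_to_derived br) -> ext_bracket q r = 0.
Proof.
rewrite mem_lker_quot_to_derived => /eqP q0; apply: ext_quot_eq => X.
by rewrite pairing_ext_bracket q0 !linear0 !zero_lfunE.
Qed.

(** The kernel consists of the classes of cycles, so by rank-nullity its dimension is that of the
    cycles minus that of the boundaries. *)
Lemma dim_lker_quot_to_derived : \dim (lker (quot_to_derived br)) = betti2 br.
Proof.
have sub : (limg (ce_delta2 br) <= lker (ce_delta1 br))%VS.
  apply/subvP => _ /memv_imgP[omega _ ->].
  by rewrite memv_ker ce_delta1_delta2.
have -> : lker (quot_to_derived br) = (ext_class br @: lker (ce_delta1 br))%VS.
  apply/vspaceP => q; rewrite mem_lker_quot_to_derived.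
  have [alpha ->] := ext_classP q; rewrite delta_quot_class.
  apply/idP/memv_imgP => [a0|[beta]].
    by exists alpha => //; rewrite memv_ker.
  rewrite memv_ker => /eqP b0 /(congr1 (delta_quot br)).
  by rewrite !delta_quot_class b0 => ->.
have := limg_ker_dim (ext_class br) (lker (ce_delta1 br)).
rewrite lker_quot_class (capv_idPr sub) => e.
have -> : betti2 br
    = (\dim (lker (ce_delta1 br)) - \dim (limg (ce_delta2 br)))%N.
  rewrite /betti2 dimvf /dim /= dimv_compl.
  congr (_ - _)%N; first exact: dimvf.
  (* Boundaries are cycles, so projecting them into the space of cycles is injective and keeps their
     dimension. *)
  apply: limg_dim_eq.
  apply/eqP; rewrite -subv0; apply/subvP => alpha.
  rewrite memv_cap memv_ker lfunE memv0 /=.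
  move=> /andP[/(subvP sub) ka /eqP/(congr1 vsval)].
  by rewrite vsprojK // linear0 => ->.
by rewrite -e addKn.
Qed.

End CentralExtensions.

(** * Gauge orbits *)

Section GaugeOrbits.
Context {K : fieldType} {g : vectType K} (br : g -> g -> g).
Hypothesis hbr : lie_bracket br.
Local Notation Z2 := (cocycles br).
Local Notation Q := (ext_quot br).

(** The transpose of the surjection onto [g, g], carried to Z^2(g) by duality. Its image is the
    space of coboundaries, along which gauge orbits extend. *)
Definition gauge_shift : 'Hom(dual (derived_alg br), Z2) :=
  ((transpose (cocycle_pairing br) \o bidual Z2)^-1
    \o transpose (quot_to_derived br))%VF.

Lemma gauge_shiftE mu (q : Q) :
  cocycle_pairing br q (gauge_shift mu) = mu (quot_to_derived br q).
Proof.
transitivity ((transpose (cocycle_pairing br) \o bidual Z2)%VF (gauge_shift mu) q).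
  by rewrite comp_lfunE transposeE bidualE.
rewrite [gauge_shift mu]comp_lfunE limg_lfunVK ?limg_transpose_pairing ?memvf //.
exact: transposeE.
Qed.

Lemma lker_gauge_shift : lker gauge_shift = 0%VS.
Proof.
apply: lker0_sep => mu m0; apply/lfunP => y.
have [q <-] := limg_fullP y (limg_quot_to_derived hbr).
by rewrite -gauge_shiftE m0 linear0 !zero_lfunE.
Qed.

(** The sign is that of [quot_to_derived], which is induced by minus delta. *)
Lemma gauge_shift_ce_d1 (mu : dual (derived_alg br)) (l : dual g) :
  (forall y, l (vsval y) = - mu y) -> vsval (gauge_shift mu) = ce_d1 br l.
Proof.
move=> lmu; apply: dual_separates => alpha.
rewrite -cocycle_pairing_class gauge_shiftE -ce_delta1E -delta_quot_class //.
by rewrite -[delta_quot _ _]opprK -quot_to_derivedE // linearN /= lmu opprK.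
Qed.

Lemma range_gauge_shift (X0 : Z2) :
  range (fun mu => X0 + gauge_shift mu) = gauge_orbit X0.
Proof.
apply/seteqP; split=> [_ [mu _ <-]|Y [l eY]].
  (* The gauge parameter extends -mu to g by a projection onto [g, g]; conversely, mu will be the
     restriction of -l. *)
  exists (- (mu \o linfun (vsproj (derived br))))%VF.
  rewrite linearD /=; congr (_ + _); apply: gauge_shift_ce_d1 => y.
  by rewrite opp_lfunE comp_lfunE lfunE /= vsvalK.
exists (- (l \o linfun (fun y : derived_alg br => vsval y)))%VF => //.
have vinj (x y : Z2) : vsval x = vsval y -> x = y by exact: val_inj.
apply: vinj; rewrite eY linearD /=; congr (_ + _).
apply: gauge_shift_ce_d1 => y.
by rewrite opp_lfunE comp_lfunE linfunE ?opprK // => a u v; rewrite linearP.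
Qed.

Lemma cocycle_on_derived_cocycle (X : Z2) :
  lie_cocycle (@derived_bracket _ _ br) (cocycle_on_derived X).
Proof.
split=> [y|x|x|x y z]; rewrite /cocycle_on_derived.
- by move=> a u v; rewrite !linearP add_lfunE scale_lfunE.
- by move=> a u v; rewrite !linearP.
- by have /mem_alternating2-> := subvsP (vsval X).
- by rewrite !derived_bracketE // (cocycle_cyclic hbr).
Qed.

End GaugeOrbits.

(** * The Poisson bracket along gauge orbits *)

Section GaugeOrbitPoisson.
Context {K : numFieldType} {g : vectType K} (br : g -> g -> g).
Hypothesis hbr : lie_bracket br.
Local Notation Z2 := (cocycles br).
Implicit Types f h : Z2 -> K.

Lemma cocycle_poissonE f h (X : Z2) :
  cocycle_poisson f h X = lie_poisson (cocycle_pairing br) (@ext_bracket _ _ br) f h X.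
Proof. by rewrite /lie_poisson cocycle_pairing_class. Qed.

(** The chain rule composes Df with [gauge_shift], whose adjoint is [quot_to_derived] by
    [gauge_shiftE]. *)
Lemma gradient_gauge_shift (X0 : Z2) f mu : smooth f ->
  gradient (bidual (derived_alg br)) (fun nu => f (X0 + gauge_shift br nu)) mu
  = quot_to_derived br (gradient (cocycle_pairing br) f (X0 + gauge_shift br mu)).
Proof.
move=> sf; rewrite /gradient differential_affine //.
set D := differential _ _.
apply: dual_separates => l.
rewrite bidual_invE comp_lfunE -gauge_shiftE //.
by rewrite pair_invK ?limg_cocycle_pairing.
Qed.

(** Translating by -nu amounts to moving the base point of the orbit, and both gradients are
    computed at the same cocycle. *)
Lemma gradient_gauge_shiftB (X0 : Z2) f mu nu : smooth f ->
  gradient (bidual (derived_alg br)) (fun mu => f (X0 + gauge_shift br (mu - nu))) mu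
  = gradient (bidual (derived_alg br)) (fun mu => f (X0 + gauge_shift br mu)) (mu - nu).
Proof.
move=> sf.
have -> : (fun mu => f (X0 + gauge_shift br (mu - nu)))
    = fun mu => f (X0 - gauge_shift br nu + gauge_shift br mu).
  by apply/funext => rho; rewrite linearB /= addrAC addrA.
have eX : X0 - gauge_shift br nu + gauge_shift br mu = X0 + gauge_shift br (mu - nu).
  by rewrite linearB /= addrAC addrA.
apply: etrans (gradient_gauge_shift (X0 - gauge_shift br nu) mu sf) _.
apply: etrans (esym (gradient_gauge_shift X0 (mu - nu) sf)).
exact: (congr1 (fun Y => quot_to_derived br (gradient (cocycle_pairing br) f Y)) eX).
Qed.

(** The bracket is linear in the cocycle: [X0] contributes the constant term, the shift by mu
    contributes mu on the bracket of [g, g]. *)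
Lemma cocycle_poisson_gauge_shift (X0 : Z2) f h mu : smooth f -> smooth h ->
  cocycle_poisson f h (X0 + gauge_shift br mu)
  = affine_lie_poisson (bidual (derived_alg br)) (@derived_bracket _ _ br)
      (cocycle_on_derived X0) (fun nu => f (X0 + gauge_shift br nu))
      (fun nu => h (X0 + gauge_shift br nu)) mu.
Proof.
move=> sf sh; rewrite /affine_lie_poisson /lie_poisson !gradient_gauge_shift //.
rewrite cocycle_poissonE /lie_poisson.
move: (gradient _ f _) (gradient _ h _) => q r.
have -> : cocycle_on_derived X0 (quot_to_derived br q) (quot_to_derived br r)
    = cocycle_pairing br (ext_bracket q r) X0.
  rewrite /cocycle_on_derived !(quot_to_derivedE hbr) pairing_ext_bracket.
  by rewrite !linearN /= opp_lfunE opprK.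
by rewrite bidualE -quot_to_derived_hom // -gauge_shiftE // linearD /= addrC.
Qed.

Lemma smooth_gauge_shift (X0 : Z2) (F : dual (derived_alg br) -> K) :
  smooth F <-> exists2 f, smooth f & F = f \o (fun mu => X0 + gauge_shift br mu).
Proof.
split=> [sF|[f sf ->]]; last exact: smooth_affine.
pose B := ((gauge_shift br)^-1)%VF.
(* [B] is a left inverse of the shift, so this extends F from the orbit to all of Z^2(g). *)
exists (fun X => F (- B X0 + B X)); first exact: smooth_affine.
apply/funext => mu /=; congr F.
by rewrite linearD /= addKr /B lker0_lfunK // lker_gauge_shift.
Qed.

End GaugeOrbitPoisson.

Lemma cocycle_poisson_bracket (R : realType) (k : real_or_complex)
    (g : vectType (scalars R k)) (br : g -> g -> g) (hbr : lie_bracket br) :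
  poisson_bracket (@cocycle_poisson _ _ br).
Proof.
have -> : @cocycle_poisson _ _ br = affine_lie_poisson (cocycle_pairing br)
    (@ext_bracket _ _ br) (fun _ _ => 0).
  apply/funext => f; apply/funext => h; apply/funext => X.
  by rewrite cocycle_poissonE /affine_lie_poisson addr0.
apply: affine_lie_poisson_bracket.
- exact: lker_cocycle_pairing.
- exact: ext_bracket_lie.
- by split=> // *; rewrite ?addr0 // => a u v; rewrite scaler0 addr0.
Qed.

Theorem proposition1p1 (R : realType) (k : real_or_complex)
    (g : vectType (scalars R k)) (br : g -> g -> g) (hbr : lie_bracket br) :
  (* Z^2(g) and the quotient of the exterior powers are dual to each other *)
  [/\ forall alpha (X : cocycles br),
        cocycle_pairing br (ext_class br alpha) X = alpha (vsval X),
      bijective (cocycle_pairing br) &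
      bijective (transpose (cocycle_pairing br) \o bidual (cocycles br))%VF]
  /\
  (* the Lie algebra structure on the quotient *)
  [/\ forall alpha, delta_quot br (ext_class br alpha) = ce_delta1 br alpha,
      forall alpha beta,
        ext_bracket (ext_class br alpha) (ext_class br beta)
        = ext_class br (wedge (ce_delta1 br alpha) (ce_delta1 br beta)) &
      lie_bracket (@ext_bracket _ _ br)]
  /\
  (* the central extension *)
  [/\ lie_bracket (@derived_bracket _ _ br),
      forall q, vsval (quot_to_derived br q) = - delta_quot br q,
      lie_hom (@ext_bracket _ _ br) (@derived_bracket _ _ br)
        (quot_to_derived br),
      limg (quot_to_derived br) = fullv &
      (forall q r, q \in lker (quot_to_derived br) -> ext_bracket q r = 0) /\
      exists i : 'Hom('rV[scalars R k]_(betti2 br), ext_quot br),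
        [/\ lie_hom (@abelian_bracket _ _) (@ext_bracket _ _ br) i,
            lker i = 0%VS & limg i = lker (quot_to_derived br)]]
  /\
  (* the Lie-Poisson structure on Z^2(g) *)
  [/\ poisson_bracket (@cocycle_poisson _ _ br) &
      forall f h, smooth f -> smooth h -> forall X,
        cocycle_poisson f h X
        = lie_poisson (cocycle_pairing br) (@ext_bracket _ _ br) f h X]
  /\
  (* the gauge orbits *)
  forall X0 : cocycles br, exists Phi : dual (derived_alg br) -> cocycles br,
    let c := cocycle_on_derived X0 in
    let pb := affine_lie_poisson (bidual (derived_alg br))
                (@derived_bracket _ _ br) c in
    [/\ forall mu q, cocycle_pairing br q (Phi mu)
          = cocycle_pairing br q X0 + mu (quot_to_derived br q),
        injective Phi /\ range Phi = gauge_orbit X0,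
        forall F, smooth F <-> exists2 f, smooth f & F = f \o Phi,
        poisson_bracket pb /\
        (forall f h, smooth f -> smooth h -> forall mu,
           cocycle_poisson f h (Phi mu) = pb (f \o Phi) (h \o Phi) mu) &
        forall nu : dual (derived_alg br),
          (forall x y, c x y = nu (derived_bracket x y)) ->
          let Psi mu := Phi (mu - nu) in
          forall f h, smooth f -> smooth h -> forall mu,
            cocycle_poisson f h (Psi mu)
            = lie_poisson (bidual (derived_alg br)) (@derived_bracket _ _ br)
                (f \o Psi) (h \o Psi) mu].

Proof.
split.
  split; first exact: cocycle_pairing_class.
    apply: bijective_lfun; [exact: lker_cocycle_pairing | exact: limg_cocycle_pairing].
  apply: bijective_lfun; first exact: lker_transpose_pairing.
  exact: limg_transpose_pairing.
split.
  split; [exact: delta_quot_class | exact: ext_bracket_class | exact: ext_bracket_lie].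
split.
  split.
  - exact: derived_bracket_lie.
  - exact: quot_to_derivedE.
  - exact: quot_to_derived_hom.
  - exact: limg_quot_to_derived.
  - split=> [q r|]; first exact: ext_bracket_central.
    have [i [ki li]] := subspace_embedding (dim_lker_quot_to_derived hbr).
    exists i; split=> // x y; rewrite ext_bracket_central ?linear0 //.
    by rewrite -li memv_img ?memvf.
split.
  by split; [exact: cocycle_poisson_bracket | move=> f h _ _ X; exact: cocycle_poissonE].
move=> X0; exists (fun mu => X0 + gauge_shift br mu) => c pb.
split.
- by move=> mu q; rewrite linearD /= gauge_shiftE.
- split; last exact: range_gauge_shift.
  move=> mu nu /addrI; apply: (elimT lker0P); exact/eqP/lker_gauge_shift.
- exact: smooth_gauge_shift.
- split; last by move=> f h sf sh mu; exact: cocycle_poisson_gauge_shift.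
  apply: affine_lie_poisson_bracket.
  + exact: lker_bidual.
  + exact: derived_bracket_lie.
  + exact: cocycle_on_derived_cocycle.
- move=> nu cnu Psi f h sf sh mu.
  have E1 := cocycle_poisson_gauge_shift hbr X0 (mu - nu) sf sh.
  apply: etrans E1 _; rewrite /affine_lie_poisson /lie_poisson.
  rewrite -!gradient_gauge_shiftB //.
  (* If the cocycle is the coboundary of nu, it cancels the term that the translation by -nu
     adds. *)
  have key a b : bidual (derived_alg br) (derived_bracket a b) (mu - nu)
      + cocycle_on_derived X0 a b = bidual (derived_alg br) (derived_bracket a b) mu.
    by rewrite -/c cnu !bidualE add_lfunE opp_lfunE subrK.
  exact: key.
Qed.
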